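(* If $K$ and $K'$ are two homotopic planar knotoids, then $$H_K(t,y,z)-H_{K'}(t,y,z)=\sum_{n\in\mathbb{N}}\left(\sum_{m\in\mathbb{N}}a_{n_m}\left(t^{z_n^m}+t^{-(z^{-1})_n^m}-2\right)\right)y^n,$$ where $a_{n_m}\in\mathbb{Z}$. Here $z_n^m$ is a notation (not a power of $z$) indicating that the exponent of $t$ is a polynomial in $z$ whose specific form depends on $n$ and $m$, and $-(z^{-1})_n^m$ is the negative of the same expression with $z$ replaced by $z^{-1}$. Furthermore, $$d_G(K,K')\geq\sum_{m\in\mathbb{N}}|a_{n_m}|\quad\text{for all } n\in\mathbb{N}.$$
   Context: **Planar knotoids.** A planar knotoid diagram $D$ is a generic immersion of the interval $[0,1]$ into $\mathbb{R}^2$ with finitely many transverse double points (crossings), each carrying over/under information. It is oriented from $0$ to $1$. The images of $0$ and $1$ are the tail and the head; both are different from the double points. The sign $\operatorname{sgn}(c)=\pm1$ of a crossing $c$ is the usual one: $+1$ if the over-strand direction is rotated counterclockwise (by less than $\pi$) to the under-strand direction, and $-1$ otherwise. Two diagrams are equivalent if they are related by a finite sequence of local planar isotopies and oriented Reidemeister moves performed away from the tail and head (pulling the arc adjacent to an endpoint over or under another arc is forbidden). The equivalence classes are called planar knotoids. **Homotopy and Gordian distance.** A crossing change exchanges the over- and undercrossing at one double point of a diagram. Two planar knotoid diagrams (or the knotoids they represent) are homotopic if they can be related by a finite sequence of crossing changes and Reidemeister moves. For homotopic planar knotoids $K,K'$, the Gordian distance $d_G(K,K')$ is the minimum number of crossing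 changes required to transform a diagram of $K$ into a diagram of $K'$. **Gauss diagram.** The Gauss diagram $G(D)$ of $D$ is a counterclockwise oriented arc of a circle, running from the tail to the head, with a chord joining the two preimages of each crossing. Each chord $c$ is directed from the overcrossing to the undercrossing and carries the sign $\operatorname{sgn}(c)$ of its crossing. $C(G(D))$ is the set of chords. For a chord $c$, let $r(c)$ (resp. $\ell(c)$) be the set of chords passing through $c$ from left to right (resp. from right to left) with respect to the direction of $c$; thus $e\in r(c)$ means that $e$ crosses $c$, starting on the left of $c$ and ending on the right. Let $r^{\pm}(c)$ and $\ell^{\pm}(c)$ be the subsets of chords of sign $\pm$. **Degree.** $d(c)=|r^+(c)|-|r^-(c)|-|\ell^+(c)|+|\ell^-(c)|$. **Index functions.** For a chord $c$ let $\phi_c:\mathbb{Z}\to\mathbb{Z}_{|d(c)|}$, $\phi_c(k)=k \bmod |d(c)|$, with $\phi_c=\mathrm{id}$ if $d(c)=0$. For $n\in\mathbb{N}$ let $r^n(c)=\{e\in r(c):\gcd(d(c),d(e))=n\}$ and $\ell^n(c)=\{e\in\ell(c):\gcd(d(c),d(e))=n\}$, where $\gcd(a,0)=\gcd(0,a)=|a|$ and $\gcd(0,0)=0$. The $n$-th index function is $$\operatorname{Ind}_c^n(z)=\sum_{e\in r^n(c)}\operatorname{sgn}(e)\,z^{\phi_c(d(e))}-\sum_{e\in\ell^n(c)}\operatorname{sgn}(e)\,z^{\phi_c(-d(e))},$$ taking values in $\mathbb{Z}[z^{\pm1}]/(z^{|d(c)|}-1)$. **The function $H_K$.** For a planar knotoid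 diagram $D$, $$H_D(t,y,z)=\sum_{c\in C(G(D)),\,n\in\mathbb{N}}\operatorname{sgn}(c)\left(t^{\operatorname{Ind}_c^n(z)}-1\right)y^n,$$ a finite sum, since $\operatorname{Ind}_c^n(z)\neq0$ for only finitely many pairs $(c,n)$. It depends only on the planar knotoid $K$ represented by $D$, and is then written $H_K(t,y,z)$. *)

(* Defs.v *)
From HB Require Import structures.
From mathcomp Require Import all_boot all_order all_algebra.
From mathcomp Require Import mathcomp_extra boolp classical_sets functions.
From mathcomp Require Import cardinality fsbigop reals topology normedtype.
From mathcomp Require Import derive.
From mathcomp.multinomials Require Import freeg.

Set Implicit Arguments.
Unset Strict Implicit.
Unset Printing Implicit Defensive.

Import Order.TTheory GRing.Theory Num.Theory.
Import numFieldNormedType.Exports.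

Local Open Scope ring_scope.
Local Open Scope classical_set_scope.

(* C^oo: all iterated directional derivatives exist and are differentiable;
   the derivatives are taken in the order in which vs is read from the right. *)
Definition smooth (R : realType) (V W : normedModType R) (f : V -> W) : Prop :=
  forall (vs : seq V) (p : V),
    differentiable (foldr (fun v g => 'D_v g) f vs) p.

Definition det2 (R : realType) (v w : R * R) : R := v.1 * w.2 - v.2 * w.1.

(* The immersion is given by a smooth map on the whole line, of which only the
   restriction to [0, 1] matters.  A crossing is encoded by the ordered pair
   (parameter of the overpass, parameter of the underpass), so that the list
   of crossings carries the over/under information.  That no parameter is
   repeated in this list excludes triple points.                             *)
Record diagram (R : realType) := Diagram {
  curve :> R -> R * R;
  crossings : seq (R * R);
  curve_smooth : smooth curve;
  curve_immersed : forall s, s \in `[0, 1] -> curve^`() s != 0;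
  crossings_double : forall s t,
    s \in `[0, 1] -> t \in `[0, 1] -> s != t ->
    curve s = curve t <-> (s, t) \in crossings \/ (t, s) \in crossings;
  crossings_uniq : uniq (unzip1 crossings ++ unzip2 crossings);
  crossings_inner : forall c, c \in crossings ->
    (0 < c.1 < 1) && (0 < c.2 < 1);
  crossings_transverse : forall c, c \in crossings ->
    det2 (curve^`() c.1) (curve^`() c.2) != 0
}.

Definition crossing_sign (R : realType) (D : diagram R) (c : R * R) : int :=
  if 0 < det2 (D^`() c.1) (D^`() c.2) then 1 else - 1.

(* F (t, p) is the position at time t of the point p. *)
Definition plane_isotopy (R : realType) (F : R * (R * R) -> R * R) : Prop :=
  [/\ smooth F,
      forall p, F (0, p) = p
    & forall t, t \in `[0, 1] -> exists2 G : R * R -> R * R,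
        smooth G &
        cancel (fun p => F (t, p)) G /\ cancel G (fun p => F (t, p))].

(* The map r allows an orientation preserving reparametrization of [0, 1]. *)
Definition isotopic (R : realType) (D D' : diagram R) : Prop :=
  exists (F : R * (R * R) -> R * R) (r : R -> R),
  [/\ plane_isotopy F,
      [/\ smooth r, r 0 = 0, r 1 = 1
        & forall s, s \in `[0, 1] -> 0 < r^`() s],
      forall s, s \in `[0, 1] -> D' s = F (1, D (r s))
    & forall s t, s \in `[0, 1] -> t \in `[0, 1] ->
        ((s, t) \in crossings D') = ((r s, r t) \in crossings D)].

(* Reidemeister moves are performed in this square; since they are combined
   with planar isotopies, this does not restrict the disc in which a move takes
   place, nor the position in it of the strands. *)
Definition square (R : realType) (p : R * R) : bool :=
  (`|p.1| <= 1) && (`|p.2| <= 1).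

(* I is the set of parameters of the strands inside the square.  In the moves
   below it is a union of intervals [a, b] with 0 < a and b < 1, hence the tail
   and the head are outside of the square. *)
Definition in_square (R : realType) (D : diagram R) (I : pred R) : Prop :=
  forall s, s \in `[0, 1] -> square (D s) = I s.

Definition local_move (R : realType) (D D' : diagram R) (I J : pred R) : Prop :=
  [/\ in_square D I, in_square D' I
    & forall s, s \in `[0, 1] -> ~~ J s -> D s = D' s].

Definition strand (R : realType) (a b : R) : pred R :=
  fun s => a <= s <= b.

Definition proper_strand (R : realType) (a b : R) : bool :=
  [&& 0 < a, a < b & b < 1].

Definition disjoint_strands (R : realType) (A B : pred R) : Prop :=
  forall s, ~~ (A s && B s).

(* The crossing between the strands parametrized by A and B, where `ov` tells
   whether A passes over B, and s, t are the parameters on A, B. *)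
Definition mkcrossing (R : realType) (ov : bool) (s t : R) : R * R :=
  if ov then (s, t) else (t, s).

Definition crossing_free (R : realType) (I : pred R) (cs : seq (R * R)) : bool :=
  all (fun c => ~~ I c.1 && ~~ I c.2) cs.

(* A strand without crossings is replaced by one with exactly one crossing (a
   self-crossing): up to isotopy of the square fixing its boundary, these are
   an embedded arc and an arc with a kink.  All four kinks are allowed, since
   the order of s and t and the sign of the crossing are arbitrary. *)
Definition reidemeister1 (R : realType) (D D' : diagram R) : Prop :=
  exists (a b s t : R),
  let A := strand a b in
  [/\ proper_strand a b,
      local_move D D' A A,
      A s /\ A t,
      crossing_free A (crossings D)
    & perm_eq (crossings D') ((s, t) :: crossings D)].

(* A runs along the x-axis; B, initially in the upper half of the square, is
   pushed across A, over it or under it, so as to intersect it exactly twice.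
   No orientation of A or B is imposed. *)
Definition reidemeister2 (R : realType) (D D' : diagram R) : Prop :=
  exists (a b c d : R) (s1 s2 t1 t2 : R) (ov : bool),
  let A := strand a b in
  let B := strand c d in
  let I := predU A B in
  [/\ [/\ proper_strand a b, proper_strand c d & disjoint_strands A B],
      local_move D D' I B,
      (forall s, A s -> (D s).2 = 0) /\ (forall t, B t -> 0 < (D t).2),
      [/\ A s1, A s2, B t1 & B t2]
    & crossing_free I (crossings D) /\
      perm_eq (crossings D')
        [:: mkcrossing ov s1 t1, mkcrossing ov s2 t2 & crossings D]].

(* B and C run along the diagonals y = x and y = -x; A meets each of them
   exactly once, in the upper half of the square before the move and in the
   lower half after it.  The levels are given by abv (A over B), bcv (B over C)
   and cav (C over A), which must not be cyclic.
   No orientation of the strands is imposed. *)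
Definition reidemeister3 (R : realType) (D D' : diagram R) : Prop :=
  exists (a1 a2 b1 b2 c1 c2 : R) (sb sc sb' sc' tb tc tb' tc' ub uc : R)
    (abv bcv cav : bool) (rest : seq (R * R)),
  let A := strand a1 a2 in
  let B := strand b1 b2 in
  let C := strand c1 c2 in
  let I := predU A (predU B C) in
  [/\ [/\ proper_strand a1 a2, proper_strand b1 b2 & proper_strand c1 c2] /\
      [/\ disjoint_strands A B, disjoint_strands A C & disjoint_strands B C],
      local_move D D' I A,
      (forall t, B t -> (D t).2 = (D t).1) /\
      (forall u, C u -> (D u).2 = - (D u).1),
      [/\ [/\ A sb, A sc, A sb' & A sc'],
          [/\ B tb, B tb', C tc & C tc'],
          B ub /\ C uc,
          0 < (D sb).2 /\ 0 < (D sc).2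
        & (D' sb').2 < 0 /\ (D' sc').2 < 0]
    & [/\ ~~ ((abv == bcv) && (bcv == cav)),
          crossing_free I rest,
          perm_eq (crossings D)
            [:: mkcrossing abv sb tb, mkcrossing cav tc sc,
                mkcrossing bcv ub uc & rest]
        & perm_eq (crossings D')
            [:: mkcrossing abv sb' tb', mkcrossing cav tc' sc',
                mkcrossing bcv ub uc & rest]]].

Definition move (R : realType) (D D' : diagram R) : Prop :=
  [\/ isotopic D D', reidemeister1 D D', reidemeister2 D D'
    | reidemeister3 D D'].

Definition crossing_change (R : realType) (D D' : diagram R) : Prop :=
  exists (c : R * R) (rest : seq (R * R)),
  [/\ forall s, s \in `[0, 1] -> D s = D' s,
      perm_eq (crossings D) (c :: rest)
    & perm_eq (crossings D') ((c.2, c.1) :: rest)].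

(* The index counts the crossing changes, which may be interspersed with
   isotopies and Reidemeister moves (in both directions). *)
Inductive transformable (R : realType) :
    nat -> diagram R -> diagram R -> Prop :=
| transformable_refl D : transformable 0 D D
| transformable_move n D D1 D2 :
    transformable n D D1 -> move D1 D2 \/ move D2 D1 -> transformable n D D2
| transformable_change n D D1 D2 :
    transformable n D D1 -> crossing_change D1 D2 -> transformable n.+1 D D2.

Definition equivalent (R : realType) (D D' : diagram R) : Prop :=
  transformable 0 D D'.

Record knotoid (R : realType) := Knotoid {
  represents : diagram R -> Prop;
  knotoid_class : exists D, represents = equivalent D
}.

Definition changes (R : realType) (K K' : knotoid R) (n : nat) : Prop :=
  exists D D', [/\ represents K D, represents K' D' & transformable n D D'].

Definition homotopic (R : realType) (K K' : knotoid R) : Prop :=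
  exists n, changes K K' n.

Lemma homotopic_asbool (R : realType) (K K' : knotoid R) :
  homotopic K K' -> exists n, `[< changes K K' n >].
Proof. by case=> n ?; exists n; apply/asboolP. Qed.

Definition gordian_distance (R : realType) (K K' : knotoid R)
    (h : homotopic K K') : nat :=
  ex_minn (homotopic_asbool h).

(* The arc of the circle is parametrized, counterclockwise from the tail to the
   head, by the parameter interval [0, 1] of the diagram.  *)
Record chord (R : realType) := Chord { over : R; under : R; sgn : int }.

Definition gauss_diagram (R : realType) (D : diagram R) : seq (chord R) :=
  [seq Chord c.1 c.2 (crossing_sign D c) | c <- crossings D].

(* The points of the circle to the right of a chord are those met when running
   counterclockwise from its initial endpoint to its terminal one; if
   under < over this arc contains the part of the circle outside [0, 1]. *)
Definition right_of (R : realType) (c : chord R) (s : R) : bool :=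
  if over c < under c then (over c < s) && (s < under c)
  else (s < under c) || (over c < s).

Definition left_of (R : realType) (c : chord R) (s : R) : bool :=
  if over c < under c then (s < over c) || (under c < s)
  else (under c < s) && (s < over c).

Section GaussDiagram.
Variables (R : realType) (G : seq (chord R)).
Implicit Types (c e : chord R) (n : nat).

Definition rset c : seq (chord R) :=
  [seq e <- G | left_of c (over e) && right_of c (under e)].

Definition lset c : seq (chord R) :=
  [seq e <- G | right_of c (over e) && left_of c (under e)].

Definition num_pos (S : seq (chord R)) : int := (count (fun e => sgn e == 1) S)%:Z.
Definition num_neg (S : seq (chord R)) : int := (count (fun e => sgn e == -1) S)%:Z.

Definition degree c : int :=
  num_pos (rset c) - num_neg (rset c) - num_pos (lset c) + num_neg (lset c).

(* modz satisfies k %% d = k %% |d| (in [0, |d|[) if d != 0, and k %% 0 = k *)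
Definition phi c (k : int) : int := (k %% degree c)%Z.

Definition rset_gcd n c : seq (chord R) :=
  [seq e <- rset c | gcdn `|degree c|%N `|degree e|%N == n].

Definition lset_gcd n c : seq (chord R) :=
  [seq e <- lset c | gcdn `|degree c|%N `|degree e|%N == n].

End GaussDiagram.

(* Z[z, z^-1], as the free abelian group on the symbols << k >> = z^k *)
Notation laurent := {freeg int / int}.

Definition zpow (k : int) : laurent := << k >>.

(* p(z^-1) *)
Definition zinv (p : laurent) : laurent :=
  \sum_(k <- dom p) coeff k p *: zpow (- k).

(* The group of exponents of t: the direct sum over N of the additive groups
   Z[z, z^-1]/(z^N - 1), i.e., the free abelian group on the pairs (N, k) where
   k is a canonical representative of a class modulo N.  The element 0 is
   shared by all the summands, hence t^0 = 1 whatever N is. *)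
Notation exponent := {freeg (nat * int) / int}.

(* the class of p in Z[z, z^-1]/(z^N - 1) *)
Definition cls (N : nat) (p : laurent) : exponent :=
  \sum_(k <- dom p) coeff k p *: << (N, (k %% N)%Z) >>.

(* The values of H are formal integer combinations of the monomials t^e y^n. *)
Notation Hvalue := {freeg (exponent * nat) / int}.

Definition ty (e : exponent) (n : nat) : Hvalue := << (e, n) >>.

Definition Ind (R : realType) (G : seq (chord R)) (n : nat) (c : chord R) :
    laurent :=
  \sum_(e <- rset_gcd G n c) sgn e *: zpow (phi G c (degree G e))
  - \sum_(e <- lset_gcd G n c) sgn e *: zpow (phi G c (- degree G e)).

Definition Hdiag (R : realType) (D : diagram R) : Hvalue :=
  let G := gauss_diagram D in
  \sum_(c <- G) \sum_(n \in [set: nat])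
    sgn c *: (ty (cls `|degree G c|%N (Ind G n c)) n - ty 0 n).

(* (t^p(z) + t^(-p(z^-1)) - 2) y^n, where p is taken modulo z^N - 1 *)
Definition bterm (N : nat) (p : laurent) (n : nat) : Hvalue :=
  ty (cls N p) n + ty (cls N (- zinv p)) n - ty 0 n *+ 2.

(* For each n, the terms with a nonzero coefficient are nonzero and pairwise
   distinct.  Note that p and - p(z^-1) give the same term, and that this
   determines the coefficients of an expansion up to their order. *)
Definition nonredundant (a : nat -> nat -> int) (N : nat -> nat -> nat)
    (z : nat -> nat -> laurent) : Prop :=
  forall n m, a n m != 0 ->
    bterm (N n m) (z n m) n != 0 /\
    forall m', a n m' != 0 -> m != m' ->
      bterm (N n m) (z n m) n != bterm (N n m') (z n m') n.

(* Main.v *)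
(* Write I(c, e) = 1 if e is in r(c), -1 if e is in l(c) and 0 otherwise. Then
   d(c) = sum_e I(c, e) sgn(e), and Ind_c^n is the sum of the
   I(c, e) sgn(e) z^(I(c, e) d(e)) over the chords e with gcd(d(c), d(e)) = n.
   Changing the crossing c replaces I(c, e), I(e, c), sgn(c), d(c) by their
   opposites and nothing else, so that Ind_c^n(z) becomes - Ind_c^n(z^-1), the
   other index functions do not change, and the coefficient of y^n in H changes
   by plus or minus a single t^p(z) + t^(-p(z^-1)) - 2. Along a shortest
   sequence of crossing changes and moves, collecting equal terms gives the
   expansion and the lower bound for the Gordian distance.

   It remains to see that H is invariant under isotopies and Reidemeister moves.
   An isotopy multiplies the determinants defining the signs by a Jacobian which
   is positive since it does not vanish along the isotopy. In the moves, the
   strands along lines cover these lines inside the square, by the intermediate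
   value theorem, hence the listed crossings are all the zeros of a coordinate
   along the moving strand; these zeros are simple, and this determines the signs
   and the order of the crossings. In the second move the two signs are opposite.
   In the third one the degrees of the three crossings satisfy a linear relation
   with coefficients 1 and -1, whence their contributions to the index functions
   of each other agree before and after the move. *)

From HB Require Import structures.
Require Import Defs.
From mathcomp Require Import all_boot all_order all_algebra.
From mathcomp Require Import mathcomp_extra boolp classical_sets functions.
From mathcomp Require Import cardinality fsbigop reals topology normedtype.
From mathcomp Require Import derive.
From mathcomp.multinomials Require Import freeg.
From mathcomp Require Import zify ring lra.

Import Order.TTheory GRing.Theory Num.Theory.
Import numFieldNormedType.Exports.
Local Open Scope ring_scope.
Local Open Scope classical_set_scope.

Set Implicit Arguments.
Unset Strict Implicit.
Unset Printing Implicit Defensive.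

(** * Laurent polynomials and exponents *)

Section FreeAbelianGroup.
Variables (K : choiceType) (M : lmodType int) (f : K -> M).

HB.instance Definition _ :=
  GRing.isZmodMorphism.Build {freeg K / int} M (fglift f) (lift_is_additive f).

(** [cls] and [zinv] are written as sums over a support; identifying such sums with extensions by
    linearity is what makes them linear. *)
Lemma fgliftE (p : {freeg K / int}) :
  fglift f p = \sum_(k <- dom p) coeff k p *: f k.
Proof.
rewrite -{1}[p]freeg_sumE raddf_sum.
by apply: eq_bigr => k _; apply: liftU.
Qed.

Lemma fglift_scalable : scalable (fglift f).
Proof. by move=> n p; rewrite -[n]intz !scaler_int raddfMz. Qed.

HB.instance Definition _ :=
  GRing.isScalable.Build int {freeg K / int} M *:%R (fglift f) fglift_scalable.

End FreeAbelianGroup.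

Lemma clsE N : cls N = fglift (fun k => << (N, (k %% N)%Z) >>).
Proof. by apply/funext => p; rewrite fgliftE. Qed.

Lemma zinvE : zinv = fglift (fun k => zpow (- k)).
Proof. by apply/funext => p; rewrite fgliftE. Qed.

Fact cls_is_linear N : linear (cls N).
Proof. by rewrite clsE; apply: linearP. Qed.

HB.instance Definition _ N :=
  GRing.isLinear.Build int laurent exponent *:%R (cls N) (cls_is_linear N).

Fact zinv_is_linear : linear zinv.
Proof. by rewrite zinvE; apply: linearP. Qed.

HB.instance Definition _ :=
  GRing.isLinear.Build int laurent laurent *:%R zinv zinv_is_linear.

Lemma cls_zpow N k : cls N (zpow k) = << (N, (k %% N)%Z) >>.
Proof. by rewrite clsE /zpow liftU; exact: scale1r. Qed.

Lemma zinv_zpow k : zinv (zpow k) = zpow (- k).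
Proof. by rewrite zinvE /zpow liftU; exact: scale1r. Qed.

Lemma cls_zpow_mod (d k : int) : cls `|d| (zpow (k %% d)%Z) = cls `|d| (zpow k).
Proof. by rewrite !cls_zpow !modz_abs modz_mod. Qed.

(** Used to exchange congruent exponents, both for parallel chords and for triangles. *)
Lemma cls_zpow_eqmod (d k l : int) :
  (d %| k - l)%Z -> cls `|d| (zpow k) = cls `|d| (zpow l).
Proof. by rewrite -eqz_mod_dvd !cls_zpow !modz_abs => /eqP ->. Qed.

Lemma bterm0 N n : bterm N 0 n = 0.
Proof. by rewrite /bterm !linear0 -mulr2n subrr. Qed.

(** * The function H in terms of intersection numbers *)

(* Only two pieces of data of a Gauss diagram matter: the sign eps c of a chord c
   and the intersection number I c e, which is 1 if e is in r(c), -1 if e is in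
   l(c) and 0 otherwise. *)
Section LinkingSystem.
Variable T : eqType.
Implicit Types (I : T -> T -> int) (eps : T -> int) (s : seq T).

Definition wdeg I eps s (c : T) : int := \sum_(e <- s) I c e * eps e.

(* The exponents are not reduced modulo the degree of c: cls does it. *)
Definition windex I eps s n (c : T) : laurent :=
  \sum_(e <- s | gcdn `|wdeg I eps s c| `|wdeg I eps s e| == n)
    (I c e * eps e) *: zpow (I c e * wdeg I eps s e).

Definition wcoef I eps s n : Hvalue :=
  \sum_(c <- s) eps c *:
    (ty (cls `|wdeg I eps s c| (windex I eps s n c)) n - ty 0 n).

Lemma wdeg_perm I eps s1 s2 : perm_eq s1 s2 -> wdeg I eps s1 =1 wdeg I eps s2.
Proof. by move=> s12 c; apply: perm_big. Qed.

Lemma windex_perm I eps s1 s2 n :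
  perm_eq s1 s2 -> windex I eps s1 n =1 windex I eps s2 n.
Proof.
move=> s12 c; rewrite /windex (perm_big _ s12).
by apply: eq_big => [e|e _]; rewrite !(wdeg_perm _ _ s12).
Qed.

Lemma wcoef_perm I eps s1 s2 n :
  perm_eq s1 s2 -> wcoef I eps s1 n = wcoef I eps s2 n.
Proof.
move=> s12; rewrite /wcoef (perm_big _ s12); apply: eq_bigr => c _.
by rewrite (wdeg_perm _ _ s12) (windex_perm _ _ _ s12).
Qed.

(** The indices are compared as classes modulo the degree only: as Laurent polynomials with
    unreduced exponents they may change in the third move. *)
Lemma wcoef_eq I1 I2 eps1 eps2 s n :
    {in s, eps1 =1 eps2} ->
    {in s, wdeg I1 eps1 s =1 wdeg I2 eps2 s} ->
    {in s, forall c, cls `|wdeg I1 eps1 s c| (windex I1 eps1 s n c) =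
                     cls `|wdeg I1 eps1 s c| (windex I2 eps2 s n c)} ->
  wcoef I1 eps1 s n = wcoef I2 eps2 s n.
Proof.
move=> heps hd hi; apply: eq_big_seq => c cs.
by rewrite heps // hi // hd.
Qed.

Lemma windex_eq I1 I2 eps1 eps2 s n c : c \in s ->
    {in s, I1 c =1 I2 c} -> {in s, eps1 =1 eps2} ->
    {in s, wdeg I1 eps1 s =1 wdeg I2 eps2 s} ->
  windex I1 eps1 s n c = windex I2 eps2 s n c.
Proof.
move=> cs hI he hd; rewrite /windex big_seq_cond [RHS]big_seq_cond.
apply: eq_big => [e|e /andP[es _]]; last by rewrite hI // he // hd.
by case: (boolP (e \in s)) => //= es; rewrite !hd.
Qed.

Lemma wcoef_ext I1 I2 eps1 eps2 s n :
    {in s &, I1 =2 I2} -> {in s, eps1 =1 eps2} ->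
  wcoef I1 eps1 s n = wcoef I2 eps2 s n.
Proof.
move=> hI he.
have hd : {in s, wdeg I1 eps1 s =1 wdeg I2 eps2 s}.
  by move=> c cs; apply: eq_big_seq => e es; rewrite hI // he.
apply: wcoef_eq => // c cs; congr cls; apply: windex_eq => // e es.
exact: hI.
Qed.

(** This is the situation of a kink. The degree and the indices of x vanish, so x contributes t^0 -
    1 = 0, and x adds nothing to the degree or index of another chord. *)
Lemma wcoef_isolated I eps x s n :
    I x x = 0 -> {in s, forall e, I x e = 0 /\ I e x = 0} ->
  wcoef I eps (x :: s) n = wcoef I eps s n.
Proof.
move=> xx xs.
have hd c : c \in s -> wdeg I eps (x :: s) c = wdeg I eps s c.
  by move=> cs; rewrite /wdeg big_cons (xs c cs).2 mul0r add0r.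
have dx : wdeg I eps (x :: s) x = 0.
  rewrite /wdeg big_cons xx mul0r add0r big_seq big1 // => e es.
  by rewrite (xs e es).1 mul0r.
rewrite /wcoef big_cons [X in X + _](_ : _ = 0) ?add0r; last first.
  rewrite /windex big_seq_cond big1 ?linear0 ?subrr ?scaler0 // => e.
  rewrite inE => /andP[/orP[/eqP ->|es] _]; first by rewrite xx mul0r scale0r.
  by rewrite (xs e es).1 mul0r scale0r.
apply: eq_big_seq => c cs; rewrite hd //; do 4 f_equal.
rewrite /windex big_cons (xs c cs).2 mul0r scale0r add0r if_same.
rewrite big_seq_cond [RHS]big_seq_cond.
apply: eq_big => [e|e /andP[es _]]; last by rewrite hd.
by case: (boolP (e \in s)) => //= es; rewrite !hd.
Qed.

(** This is the situation of the second move. The chords x and y have the same degree, the same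
    intersections with the others and opposite signs: their contributions to every other chord
    cancel, and so do their own terms, since their indices agree modulo that degree. *)
Lemma wcoef_cancel I eps x y s n :
    I x x = 0 -> I y y = 0 -> I y x = - I x y -> eps y = - eps x ->
    {in s, forall e, I x e = I y e /\ I e x = I e y} ->
  wcoef I eps [:: x, y & s] n = wcoef I eps s n.
Proof.
move=> xx yy yx exy xys; set s' := [:: x, y & s].
have hd c : c \in s -> wdeg I eps s' c = wdeg I eps s c.
  move=> cs; rewrite /wdeg !big_cons (xys c cs).2 exy; ring.
have dxy : wdeg I eps s' x = wdeg I eps s' y.
  rewrite /wdeg !big_cons xx yy yx exy !mul0r mulrN mulNr !add0r; congr (_ + _).
  by apply: eq_big_seq => e es; rewrite (xys e es).1.
set d := wdeg I eps s' x in dxy.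
have ixy : cls `|d| (windex I eps s' n x) = cls `|d| (windex I eps s' n y).
  rewrite /windex !linear_sum !big_cons /= -/d -dxy xx yy.
  rewrite !mul0r !scale0r linear0 add0r add0r !if_same.
  have -> : I x y * eps y = I y x * eps x by rewrite yx exy; ring.
  (* The exponents with which x and y enter the index of each other are opposite multiples of d,
     hence congruent. *)
  rewrite !linearZ /= (@cls_zpow_eqmod d (I x y * d) (I y x * d)); last first.
    by rewrite -mulrBl dvdz_mull.
  suff -> : \sum_(e <- s | gcdn `|d| `|wdeg I eps s' e| == n)
      cls `|d| ((I x e * eps e) *: zpow (I x e * wdeg I eps s' e)) =
    \sum_(e <- s | gcdn `|d| `|wdeg I eps s' e| == n)
      cls `|d| ((I y e * eps e) *: zpow (I y e * wdeg I eps s' e)) by [].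
  rewrite big_seq_cond [RHS]big_seq_cond.
  by apply: eq_bigr => e /andP[es _]; rewrite (xys e es).1.
rewrite /wcoef !big_cons -/d -dxy ixy exy addrA scaleNr addrN add0r.
apply: eq_big_seq => c cs; rewrite hd //; do 4 f_equal.
rewrite {1}/windex !big_cons -dxy -/d (xys c cs).2 exy.
rewrite (_ : \sum_(e <- s | _) _ = windex I eps s n c); last first.
  rewrite /windex big_seq_cond [RHS]big_seq_cond.
  apply: eq_big => [e|e /andP[es _]]; last by rewrite hd.
  by case: (boolP (e \in s)) => //= es; rewrite !hd.
by case: ifP => [->|->] //; rewrite mulrN scaleNr addrA addrN add0r.
Qed.

(* Changing the crossing x reverses its chord and its sign, hence preserves
   all products I e x * eps x and all degrees but that of x, which is negated. *)
Lemma wcoef_flip I1 I2 eps1 eps2 x s n :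
    I1 x x = 0 -> I2 x x = 0 -> {in s &, I1 =2 I2} -> {in s, eps1 =1 eps2} ->
    {in s, forall e, I2 x e = - I1 x e /\ I2 e x = - I1 e x} ->
    eps2 x = - eps1 x ->
  wcoef I1 eps1 (x :: s) n - wcoef I2 eps2 (x :: s) n =
    eps1 x *: bterm `|wdeg I1 eps1 (x :: s) x| (windex I1 eps1 (x :: s) n x) n.
Proof.
move=> xx1 xx2 hI he hx hex; set s' := x :: s.
have hd c : c \in s -> wdeg I2 eps2 s' c = wdeg I1 eps1 s' c.
  move=> cs; rewrite /wdeg !big_cons (hx c cs).2 hex mulrNN; congr (_ + _).
  by apply: eq_big_seq => e es; rewrite hI // he.
have dx : wdeg I2 eps2 s' x = - wdeg I1 eps1 s' x.
  rewrite /wdeg !big_cons xx1 xx2 !mul0r !add0r -sumrN.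
  by apply: eq_big_seq => e es; rewrite (hx e es).1 he // mulNr.
have hi c : c \in s -> windex I2 eps2 s' n c = windex I1 eps1 s' n c.
  move=> cs; rewrite /windex !big_cons dx hd // abszN (hx c cs).2 hex !mulrNN.
  suff -> : \sum_(e <- s | gcdn `|wdeg I1 eps1 s' c| `|wdeg I2 eps2 s' e| == n)
      (I2 c e * eps2 e) *: zpow (I2 c e * wdeg I2 eps2 s' e) =
    \sum_(e <- s | gcdn `|wdeg I1 eps1 s' c| `|wdeg I1 eps1 s' e| == n)
      (I1 c e * eps1 e) *: zpow (I1 c e * wdeg I1 eps1 s' e) by [].
  rewrite big_seq_cond [RHS]big_seq_cond.
  apply: eq_big => [e|e /andP[es _]]; last by rewrite hd // hI // he.
  by case: (boolP (e \in s)) => //= es; rewrite !hd.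
have ix : windex I2 eps2 s' n x = - zinv (windex I1 eps1 s' n x).
  rewrite /windex !big_cons xx1 xx2 !mul0r !scale0r !add0r !if_same.
  rewrite (linear_sum zinv) -sumrN big_seq_cond [RHS]big_seq_cond.
  apply: eq_big => [e|e /andP[es _]].
    by case: (boolP (e \in s)) => //= es; rewrite dx abszN (hd e).
  rewrite linearZ /= zinv_zpow hd // (hx e es).1 he //.
  by rewrite !mulNr scaleNr.
rewrite /wcoef !big_cons dx ix abszN hex.
set A := \sum_(c <- s) _; rewrite [X in _ - (_ + X)](_ : _ = A); last first.
  by apply: eq_big_seq => c cs; rewrite hd // hi // he.
rewrite opprD addrACA addrN addr0 scaleNr opprK -scalerDr /bterm; congr (_ *: _).
by rewrite mulr2n opprD addrACA.
Qed.

End LinkingSystem.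

Lemma wdeg_map (T T' : eqType) (f : T -> T') I eps s c :
  wdeg I eps (map f s) (f c) = wdeg (fun c e => I (f c) (f e)) (eps \o f) s c.
Proof. by rewrite /wdeg big_map. Qed.

Lemma windex_map (T T' : eqType) (f : T -> T') I eps s n c :
  windex I eps (map f s) n (f c) =
  windex (fun c e => I (f c) (f e)) (eps \o f) s n c.
Proof.
by rewrite /windex big_map; apply: eq_big => [e|e _]; rewrite !wdeg_map.
Qed.

Lemma wcoef_map (T T' : eqType) (f : T -> T') I eps s n :
  wcoef I eps (map f s) n =
  wcoef (fun c e => I (f c) (f e)) (eps \o f) s n.
Proof.
rewrite /wcoef big_map; apply: eq_bigr => c _.
by rewrite wdeg_map windex_map.
Qed.

(** * Three crossings forming a triangle *)

Definition is_sign (x : int) : Prop := x = 1 \/ x = -1.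

(** The relation makes dy a combination of dx and dz in which dz has coefficient 1 or -1. *)
Lemma gcdn_abs_linear (ox oy oz dx dy dz : int) :
    is_sign oy -> is_sign oz -> ox * dx + oy * dy + oz * dz = 0 ->
  gcdn `|dx| `|dy| = gcdn `|dx| `|dz|.
Proof.
move=> hy hz rel.
have : gcdz dx dy = gcdz dx dz.
  have -> : dy = (- oy * ox) * dx + (- oy * oz) * dz.
    by case: hy rel => ->; case: hz => -> rel; lia.
  rewrite gcdzMDl; case: hy => ->; case: hz => ->;
  by rewrite ?(opprK, mulrN1, mulN1r, mul1r, mulr1) ?gcdzN.
by case.
Qed.

Lemma mulr2n_int_inj (i j : int) : i *+ 2 = j *+ 2 -> i = j.
Proof. lia. Qed.

(* The contribution to the degree and to the index of a crossing c of a triangle,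
   before and after the move, of the two other crossings: up to the over/under
   signs, their degrees d1 and d2 are opposite modulo dc. *)
Lemma triangle_index (M : lmodType int) (E : int -> M) (n : nat)
    (p q tau delta oc o1 o2 dc d1 d2 : int) (i1 i2 j1 j2 eps1 eps2 : int) :
    is_sign p -> is_sign q -> is_sign tau -> is_sign delta ->
    is_sign oc -> is_sign o1 -> is_sign o2 ->
    (forall k l, (dc %| k - l)%Z -> E k = E l) ->
    oc * dc + o1 * d1 + o2 * d2 = 0 ->
    i1 *+ 2 = oc * o1 * (tau - q) -> i2 *+ 2 = - (oc * o2 * (tau - p)) ->
    j1 *+ 2 = oc * o1 * (tau + q) -> j2 *+ 2 = - (oc * o2 * (tau + p)) ->
    eps1 = o1 * delta * p -> eps2 = o2 * delta * q ->
  i1 * eps1 + i2 * eps2 = j1 * eps1 + j2 * eps2 /\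
  (if gcdn `|dc| `|d1| == n then (i1 * eps1) *: E (i1 * d1) else 0) +
  (if gcdn `|dc| `|d2| == n then (i2 * eps2) *: E (i2 * d2) else 0) =
  (if gcdn `|dc| `|d1| == n then (j1 * eps1) *: E (j1 * d1) else 0) +
  (if gcdn `|dc| `|d2| == n then (j2 * eps2) *: E (j2 * d2) else 0).
Proof.
move=> hp hq ht hd hc h1 h2 hE rel hi1 hi2 hj1 hj2 -> ->.
rewrite (gcdn_abs_linear h1 h2 rel).
(* Splits off the over/under factor [oc * o]; the remaining integers depend on p, q and tau only. *)
have red o i e : is_sign o -> i *+ 2 = oc * o * e ->
    exists2 k, i = oc * o * k & k *+ 2 = e.
  by move=> ho ie; exists (oc * o * i); case: hc ie => ->; case: ho => ->; lia.
rewrite -mulrN in hi2; rewrite -mulrN in hj2.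
have [k1 -> k1E] := red _ _ _ h1 hi1; have [k2 -> k2E] := red _ _ _ h2 hi2.
have [l1 -> l1E] := red _ _ _ h1 hj1; have [l2 -> l2E] := red _ _ _ h2 hj2.
pose u k := E (oc * k * (o1 * d1)).
have E1 k : E (oc * o1 * k * d1) = u k by congr E; ring.
(* By the linear relation, [o2 * d2] is congruent to [- (o1 * d1)] modulo dc. *)
have E2 k : E (oc * o2 * k * d2) = u (- k).
  apply: hE; rewrite (_ : _ - _ = - (oc * k * oc) * dc) ?dvdz_mull //.
  have -> : dc = - oc * (o1 * d1 + o2 * d2) by case: hc rel => ->; lia.
  by case: hc => ->; ring.
have cE o k e : is_sign o -> oc * o * k * (o * delta * e) = oc * delta * (k * e).
  by case=> ->; ring.
rewrite !E1 !E2 !cE // -!mulrDr -!(scalerA (oc * delta)).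
suff [-> core] : k1 * p + k2 * q = l1 * p + l2 * q /\
    (k1 * p) *: u k1 + (k2 * q) *: u (- k2) = (l1 * p) *: u l1 + (l2 * q) *: u (- l2).
  by split=> //; case: ifP => // _; rewrite -!scalerDr core.
clear -hp hq ht k1E k2E l1E l2E.
(* The eight choices of p, q and tau determine the four integers, each of which is 0, 1 or -1; in
   every case the terms match or cancel. *)
case: hp k2E l2E => -> k2E l2E; case: hq k1E l1E => -> k1E l1E; case: ht => tauE;
  rewrite tauE in k1E k2E l1E l2E.
all: first [have -> : k1 = 0 by lia | have -> : k1 = 1 by lia | have -> : k1 = -1 by lia].
all: first [have -> : k2 = 0 by lia | have -> : k2 = 1 by lia | have -> : k2 = -1 by lia].
all: first [have -> : l1 = 0 by lia | have -> : l1 = 1 by lia | have -> : l1 = -1 by lia].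
all: first [have -> : l2 = 0 by lia | have -> : l2 = 1 by lia | have -> : l2 = -1 by lia].
all: rewrite ?(mul1r, mulN1r, mul0r, opprK, scale1r, scaleN1r, scale0r).
all: by rewrite ?(addr0, add0r, addrN, addNr).
Qed.

(* x, y, z are the crossings AB, BC, CA of three strands A, B, C. The order of
   the strands on the interval gives tau, and that of the two crossings on A, B, C
   gives sA, sB, sC, which are all reversed by the move. The over/under
   information ox, oy, oz only multiplies intersection numbers and signs, so that
   cyclic levels need not be excluded. *)
Lemma wcoef_triangle (T : eqType) (I1 I2 : T -> T -> int) (eps : T -> int)
    (x y z : T) (s : seq T) (n : nat)
    (sA sB sC tau delta ox oy oz : int) :
    is_sign sA -> is_sign sB -> is_sign sC -> is_sign tau -> is_sign delta ->
    is_sign ox -> is_sign oy -> is_sign oz ->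
    [/\ I1 x x = 0, I1 y y = 0 & I1 z z = 0] ->
    [/\ I2 x x = 0, I2 y y = 0 & I2 z z = 0] ->
    [/\ I1 y x = - I1 x y, I1 z y = - I1 y z & I1 x z = - I1 z x] ->
    [/\ I2 y x = - I2 x y, I2 z y = - I2 y z & I2 x z = - I2 z x] ->
    [/\ I1 x y *+ 2 = ox * oy * (tau - sB),
        I1 y z *+ 2 = oy * oz * (tau - sC) &
        I1 z x *+ 2 = oz * ox * (tau - sA)] ->
    [/\ I2 x y *+ 2 = ox * oy * (tau + sB),
        I2 y z *+ 2 = oy * oz * (tau + sC) &
        I2 z x *+ 2 = oz * ox * (tau + sA)] ->
    [/\ eps x = ox * delta * sC, eps y = oy * delta * sA &
        eps z = oz * delta * sB] ->
    {in s, forall e, ox * I1 x e + oy * I1 y e + oz * I1 z e = 0} ->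
    {in s, forall e, [/\ I2 x e = I1 x e, I2 y e = I1 y e & I2 z e = I1 z e]} ->
    {in s, forall c, {in [:: x, y, z & s], I2 c =1 I1 c}} ->
  wcoef I1 eps [:: x, y, z & s] n = wcoef I2 eps [:: x, y, z & s] n.
Proof.
move=> hA hB hC ht hd hox hoy hoz [xx1 yy1 zz1] [xx2 yy2 zz2].
move=> [yx1 zy1 xz1] [yx2 zy2 xz2] [xy1 yz1 zx1] [xy2 yz2 zx2] [ex ey ez].
move=> rels agree agrees; set s' := [:: x, y, z & s].
(* The linear relation between the three degrees: the chords of s drop out by [rels], the mutual
   contributions by [loc]. *)
have rel : ox * wdeg I1 eps s' x + oy * wdeg I1 eps s' y +
           oz * wdeg I1 eps s' z = 0.
  (* The expression vanishes by antisymmetry once the signs are factored out. *)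
  have loc : ox * (I1 x y * eps y + I1 x z * eps z) +
             oy * (I1 y x * eps x + I1 y z * eps z) +
             oz * (I1 z x * eps x + I1 z y * eps y) = 0.
    suff : (ox * (I1 x y * eps y + I1 x z * eps z) +
             oy * (I1 y x * eps x + I1 y z * eps z) +
             oz * (I1 z x * eps x + I1 z y * eps y)) *+ 2 = 0 by lia.
    rewrite yx1 zy1 xz1 ex ey ez; transitivity (
      (I1 x y *+ 2) * (ox * oy * delta * sA - oy * ox * delta * sC) +
      (I1 y z *+ 2) * (oy * oz * delta * sB - oz * oy * delta * sA) +
      (I1 z x *+ 2) * (oz * ox * delta * sC - ox * oz * delta * sB)).
      ring.
    have sq (u : int) : is_sign u -> u * u = 1 by case=> ->.
    rewrite xy1 yz1 zx1; move: (sq _ hox) (sq _ hoy) (sq _ hoz) => qx qy qz.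
    transitivity (delta * (
      (tau - sB) * (sA - sC) * (ox * ox) * (oy * oy) +
      (tau - sC) * (sB - sA) * (oy * oy) * (oz * oz) +
      (tau - sA) * (sC - sB) * (oz * oz) * (ox * ox))); first ring.
    rewrite qx qy qz; ring.
  rewrite /wdeg !big_cons xx1 yy1 zz1 !mul0r !add0r.
  set X := \sum_(e <- s) _; set Y := \sum_(e <- s) _; set Z := \sum_(e <- s) _.
  have : ox * X + oy * Y + oz * Z = 0.
    rewrite !mulr_sumr -!big_split big_seq big1 //= => e es.
    by rewrite !mulrA -!mulrDl rels // mul0r.
  move: loc; lia.
have relC (a b c u v w : int) : a * u + b * v + c * w = 0 ->
  b * v + c * w + a * u = 0 by lia.
have hE c k l : (wdeg I1 eps s' c %| k - l)%Z ->
    cls `|wdeg I1 eps s' c| (zpow k) = cls `|wdeg I1 eps s' c| (zpow l).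
  exact: cls_zpow_eqmod.
have xz1' : I1 x z *+ 2 = - (ox * oz * (tau - sA)) by rewrite xz1; lia.
have yx1' : I1 y x *+ 2 = - (oy * ox * (tau - sB)) by rewrite yx1; lia.
have zy1' : I1 z y *+ 2 = - (oz * oy * (tau - sC)) by rewrite zy1; lia.
have xz2' : I2 x z *+ 2 = - (ox * oz * (tau + sA)) by rewrite xz2; lia.
have yx2' : I2 y x *+ 2 = - (oy * ox * (tau + sB)) by rewrite yx2; lia.
have zy2' : I2 z y *+ 2 = - (oz * oy * (tau + sC)) by rewrite zy2; lia.
(* Each crossing in turn is the distinguished one, the data being permuted cyclically. *)
have loc_x := triangle_index _ hA hB ht hd hox hoy hoz (hE x) rel
  xy1 xz1' xy2 xz2' ey ez.
have loc_y := triangle_index _ hB hC ht hd hoy hoz hox (hE y) (relC _ _ _ _ _ _ rel)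
  yz1 yx1' yz2 yx2' ez ex.
have loc_z := triangle_index _ hC hA ht hd hoz hox hoy (hE z)
  (relC _ _ _ _ _ _ (relC _ _ _ _ _ _ rel)) zx1 zy1' zx2 zy2' ex ey.
(* The degrees agree by the first half of [triangle_index], which holds for every n; the instance at
   0 is taken. *)
have degE : {in s', wdeg I1 eps s' =1 wdeg I2 eps s'}.
  have ext c : {in s, I2 c =1 I1 c} -> 
    \sum_(e <- s) I2 c e * eps e = \sum_(e <- s) I1 c e * eps e.
    by move=> h; apply: eq_big_seq => e es; rewrite h.
  move=> c; rewrite !inE => /or4P[/eqP ->|/eqP ->|/eqP ->|cs].
  - rewrite /wdeg !big_cons xx1 xx2 !mul0r !add0r !addrA (loc_x 0).1 ext //.
    by move=> e /agree[].
  - rewrite /wdeg !big_cons yy1 yy2 !mul0r !add0r !addrA.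
    rewrite [I1 y x * _ + _]addrC [I2 y x * _ + _]addrC (loc_y 0).1 ext //.
    by move=> e /agree[].
  - rewrite /wdeg !big_cons zz1 zz2 !mul0r !add0r !addrA (loc_z 0).1 ext //.
    by move=> e /agree[].
  - by apply: eq_big_seq => e es; rewrite agrees.
apply: wcoef_eq => // c; rewrite !inE => cs'.
have ext b : b \in [:: x; y; z] -> 
  cls `|wdeg I1 eps s' b|
    (\sum_(e <- s | gcdn `|wdeg I1 eps s' b| `|wdeg I1 eps s' e| == n)
      (I2 b e * eps e) *: zpow (I2 b e * wdeg I1 eps s' e)) =
  cls `|wdeg I1 eps s' b|
    (\sum_(e <- s | gcdn `|wdeg I1 eps s' b| `|wdeg I1 eps s' e| == n)
      (I1 b e * eps e) *: zpow (I1 b e * wdeg I1 eps s' e)).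
  move=> bxyz; rewrite big_seq_cond [in RHS]big_seq_cond; congr cls.
  apply: eq_bigr => e /andP[/agree[hx hy hz] _].
  by move: bxyz; rewrite !inE => /or3P[]/eqP ->; rewrite ?hx ?hy ?hz.
have -> : windex I2 eps s' n c = 
  \sum_(e <- s' | gcdn `|wdeg I1 eps s' c| `|wdeg I1 eps s' e| == n)
   (I2 c e * eps e) *: zpow (I2 c e * wdeg I1 eps s' e).
  rewrite /windex big_seq_cond [RHS]big_seq_cond.
  apply: eq_big => [e|e /andP[es _]]; last by rewrite degE.
  by case: (boolP (e \in s')) => // es; rewrite !degE // !inE.
have mk b (p : laurent) q N :
  cls N (if b then p + q else q) = (if b then cls N p else 0) + cls N q.
  by case: b; rewrite ?linearD ?add0r.
have mk0 e : (0 * eps e) *: zpow (0 * wdeg I1 eps s' e) = 0 by rewrite mul0r scale0r.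
have if0 b N : (if b then cls N 0 else 0) = 0 by rewrite linear0 if_same.
have mkZ b k l N :
    (if b then cls N (k *: zpow l) else 0) = (if b then k *: cls N (zpow l) else 0).
  by case: b; rewrite ?linearZ.
case/or4P: cs' => [/eqP ->|/eqP ->|/eqP ->|cs].
- rewrite /windex !big_cons xx1 xx2 !mk0 !mk !if0 !add0r !mkZ ext ?mem_head //.
  by rewrite !addrA (loc_x n).2.
- rewrite /windex !big_cons yy1 yy2 !mk0 !mk !if0 !add0r !mkZ ext; last first.
    by rewrite !inE eqxx orbT.
  by rewrite !addrA; congr (_ + _); rewrite addrC [RHS]addrC (loc_y n).2.
- rewrite /windex !big_cons zz1 zz2 !mk0 !mk !if0 !add0r !mkZ ext; last first.
    by rewrite !inE eqxx !orbT.
  by rewrite !addrA (loc_z n).2.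
- congr cls; rewrite /windex big_seq_cond [RHS]big_seq_cond.
  by apply: eq_bigr => e /andP[es _]; rewrite agrees.
Qed.

(** * Intersection numbers of crossings *)

Section Intersection.
Variable R : realType.
Implicit Types (c e : R * R) (D : diagram R).

(** The sides of a chord depend on its endpoints only, so the sign 1 given to the auxiliary chord is
    an arbitrary choice. *)
Definition inter c e : int :=
  let c' := Chord c.1 c.2 1 in
  (left_of c' e.1 && right_of c' e.2)%:Z - (right_of c' e.1 && left_of c' e.2)%:Z.

Lemma sgz_sub (x y : R) : x != y -> sgz (x - y) = if x < y then -1 else 1.
Proof.
move=> xy; case: ltgtP xy => // xy _; first by rewrite ltr0_sgz // subr_lt0.
by rewrite gtr0_sgz // subr_gt0.
Qed.

Lemma inter_self c : inter c c = 0.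
Proof.
rewrite /inter /left_of /right_of /= !ltxx.
by case: ltgtP => // _; rewrite ?andbF.
Qed.

(** As a function of s, [sgz (c.2 - s) - sgz (c.1 - s)] is constant on each side of c and larger by
    2 on the right; the formula is its increment from the initial to the terminal end of e. Doubling
    avoids a division and reduces later computations to linear arithmetic. *)
Lemma interE c e : uniq [:: c.1; c.2; e.1; e.2] ->
  inter c e *+ 2 = sgz (c.2 - e.2) - sgz (c.1 - e.2) - sgz (c.2 - e.1)
                   + sgz (c.1 - e.1).
Proof.
rewrite /= !inE !negb_or => /and4P[/and3P[n12 n13 n14] /andP[n23 n24] n34 _].
rewrite !sgz_sub // /inter /left_of /right_of /=.
case: (ltgtP c.1 c.2) n12 => // h12 _; case: (ltgtP c.1 e.1) n13 => // h13 _;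
case: (ltgtP c.1 e.2) n14 => // h14 _; case: (ltgtP c.2 e.1) n23 => // h23 _;
case: (ltgtP c.2 e.2) n24 => // h24 _; case: (ltgtP e.1 e.2) n34 => // h34 _ //=;
  exfalso; lra.
Qed.
End Intersection.

Lemma fsbig_nat_lt (V : nmodType) (F : nat -> V) (M : nat) :
    (forall n, (M <= n)%N -> F n = 0) ->
  \sum_(n \in [set: nat]) F n = \sum_(0 <= n < M) F n.
Proof.
move=> F0; rewrite big_mkord fsbig_ord.
apply/esym/fsbig_widen => // n [_ /= /negP]; rewrite -leqNgt; exact: F0.
Qed.

(** * Comparison of [Hdiag] with the coefficients [Hcoef] *)

Section HPolynomial.
Variable R : realType.
Implicit Types (c e : R * R) (D : diagram R) (s : seq (R * R)) (n : nat).

Definition toChord (eps : R * R -> int) c : chord R := Chord c.1 c.2 (eps c).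

Lemma crossing_sign_is_sign D c : is_sign (crossing_sign D c).
Proof. by rewrite /crossing_sign; case: ifP; [left|right]. Qed.

Definition Hcoef D n : Hvalue :=
  wcoef (@inter R) (crossing_sign D) (crossings D) n.

Lemma degree_map (eps : R * R -> int) s c :
    (forall c, is_sign (eps c)) ->
  degree (map (toChord eps) s) (toChord eps c) = wdeg (@inter R) eps s c.
Proof.
move=> heps; rewrite /wdeg /degree /num_pos /num_neg /rset /lset.
elim: s => [|e s IH]; first by rewrite big_nil.
rewrite big_cons -IH /= /inter /left_of /right_of /=.
by case: (heps e) => he; do 2 case: ifP => _ /=; rewrite ?he //=; lia.
Qed.

(** [Ind] separates the chords by direction and reduces exponents by [phi], while [windex] is one
    signed sum without reduction; modulo the degree they agree chord by chord. *)
Lemma cls_Ind_map (eps : R * R -> int) s n c :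
    (forall c, is_sign (eps c)) ->
  let G := map (toChord eps) s in
  let d := wdeg (@inter R) eps s c in
  cls `|d| (Ind G n (toChord eps c)) =
  cls `|d| (windex (@inter R) eps s n c).
Proof.
move=> heps G d; rewrite /Ind /rset_gcd /lset_gcd /rset /lset -!filter_predI.
rewrite !big_filter !big_map /windex linearB !(linear_sum (cls _)) /=.
rewrite big_mkcond [X in _ - X]big_mkcond [RHS]big_mkcond -sumrB /=.
apply: eq_bigr => e _; rewrite /phi !degree_map // -/d !linearZ_LR /=.
have ck k : cls `|d| (zpow (k %% d)%Z) = cls `|d| (zpow k) := cls_zpow_mod d k.
rewrite !ck; case: eqP => _ /=; last by rewrite subr0.
set l1 := left_of _ _; set r1 := right_of _ _.
set l2 := right_of _ _; set r2 := left_of _ _.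
have -> : inter c e = (l1 && r1)%:Z - (l2 && r2)%:Z by [].
(* No chord crosses c in both directions, so at most one of the two terms is present. *)
have : ~~ ((l1 && r1) && (l2 && r2)).
  rewrite /l1 /l2 /left_of /right_of /=.
  by do 2 case: ltgtP => //=; do 4 case: ltgtP => //=; lra.
case: (l1 && r1); case: (l2 && r2) => //= _; rewrite ?subr0 ?sub0r ?subrr.
- by rewrite !mul1r.
- by rewrite !mulN1r scaleNr.
- by rewrite !mul0r scale0r.
Qed.

(** For n above every gcd of two degrees no chord enters an index, so the sum over n is finite. All
    N from M on are allowed, so that two diagrams can be cut off at the same bound. *)
Lemma Hdiag_Hcoef D :
  exists M, forall N, (M <= N)%N ->
    (forall n c, (N <= n)%N -> c \in crossings D ->
      windex (@inter R) (crossing_sign D) (crossings D) n c = 0) /\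
    Hdiag D = \sum_(0 <= n < N) Hcoef D n.
Proof.
set s := crossings D; set eps := crossing_sign D.
pose g c e := gcdn `|wdeg (@inter R) eps s c| `|wdeg (@inter R) eps s e|.
exists (\max_(c <- s) \max_(e <- s) g c e).+1 => N leN.
have big n c : (N <= n)%N -> c \in s -> windex (@inter R) eps s n c = 0.
  move=> leNn cs; rewrite /windex big_seq_cond big1 // => e /andP[es /eqP gn].
  have := leq_trans leN leNn; rewrite -gn ltnNge.
  by rewrite (leq_trans _ (leq_bigmax_seq _ cs isT)) // (leq_bigmax_seq _ es isT).
have heps := crossing_sign_is_sign D.
split=> //; rewrite /Hdiag /gauss_diagram big_map -/s exchange_big /=.
apply: eq_big_seq => c cs.
rewrite -/eps; rewrite (@fsbig_nat_lt _ _ N) => [|n leNn]; rewrite -/(toChord eps _).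
  by apply: eq_bigr => n _; rewrite -/(map (toChord eps) s) degree_map // cls_Ind_map.
rewrite -/(map (toChord eps) s) degree_map // cls_Ind_map // big // linear0.
by rewrite subrr scaler0.
Qed.

End HPolynomial.

(** * Real functions and smooth curves *)

Section RealFunctions.
Variable R : realType.
Implicit Types (f : R -> R) (a b d t x : R).

Lemma no_zero_pos f a b : continuous f -> a <= b -> 0 < f a ->
  (forall x, a <= x <= b -> f x != 0) -> 0 < f b.
Proof.
move=> cf ab fa nz; rewrite lt_neqAle eq_sym nz ?ab ?lexx //= leNgt.
apply/negP => fb.
have [||x] := @IVT R f a b 0 ab.
- exact: continuous_subspaceT.
- by rewrite ge_min le_max (ltW fa) (ltW fb) orbT.
by rewrite in_itv /= => /nz /eqP.
Qed.

Lemma no_zero_pos_left f a b : continuous f -> a <= b -> 0 < f b ->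
  (forall x, a <= x <= b -> f x != 0) -> 0 < f a.
Proof.
move=> cf ab fb nz; rewrite lt_neqAle eq_sym nz ?ab ?lexx //= leNgt.
apply/negP => fa.
have [||x] := @IVT R f a b 0 ab.
- exact: continuous_subspaceT.
- by rewrite ge_min le_max (ltW fa) (ltW fb) orbT.
by rewrite in_itv /= => /nz /eqP.
Qed.

Lemma is_derive_near f t d : is_derive t (1 : R) f d -> 0 < d -> f t = 0 ->
  forall e, 0 < e ->
    (exists2 x, t - e < x < t & f x < 0) /\ (exists2 x, t < x < t + e & 0 < f x).
Proof.
move=> ftd d0 ft e e0.
have cv : (fun h => h^-1 *: (f (h *: 1 + t) - f t)) @ 0^' --> d.
  by rewrite -(@derive_val _ _ _ _ _ _ _ ftd); apply: (@ex_derive _ _ _ _ _ _ _ ftd).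
split.
- have ql : \forall h \near 0^'-, 0 < h^-1 *: (f (h *: 1 + t) - f t).
    exact: (cvgr_gt _ (cvg_dnbhs_at_left cv) _ d0).
  near (0 : R)^'- => h.
  have h0 : h < 0 by near: h; exact: nbhs_left_lt.
  have he : - e < h by near: h; apply: nbhs_left_gt; lra.
  exists (h + t); first by apply/andP; split; lra.
  have : 0 < h^-1 * (f (h * 1 + t) - f t) by near: h.
  by rewrite ft subr0 mulr1 nmulr_rgt0 // invr_lt0.
- have qr : \forall h \near 0^'+, 0 < h^-1 *: (f (h *: 1 + t) - f t).
    exact: (cvgr_gt _ (cvg_dnbhs_at_right cv) _ d0).
  near (0 : R)^'+ => h.
  have h0 : 0 < h by near: h; exact: nbhs_right_gt.
  have he : h < e by near: h; apply: nbhs_right_lt.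
  exists (h + t); first by apply/andP; split; lra.
  have : 0 < h^-1 * (f (h * 1 + t) - f t) by near: h.
  by rewrite ft subr0 mulr1 pmulr_rgt0 // invr_gt0.
Unshelve. all: by end_near. Qed.

(** A positive derivative would give a negative value just before t, hence a zero between a and
    t. *)
Lemma derive_lt0_left f a t d : continuous f -> is_derive t (1 : R) f d ->
  f t = 0 -> d != 0 -> a < t -> 0 < f a -> (forall x, a <= x < t -> f x != 0) ->
  d < 0.
Proof.
move=> cf fd ft d0 aLt fa nz; rewrite lt_neqAle d0 leNgt; apply/negP => dp.
have [|[x /andP[tx xt] fx] _] := is_derive_near fd dp ft (e := t - a); first lra.
have : 0 < f x; last lra.
apply: no_zero_pos fa _ => // [|y /andP[ay yx]]; first lra.
by apply: nz; rewrite ay; lra.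
Qed.

Lemma derive_gt0_right f b t d : continuous f -> is_derive t (1 : R) f d ->
  f t = 0 -> d != 0 -> t < b -> 0 < f b -> (forall x, t < x <= b -> f x != 0) ->
  0 < d.
Proof.
move=> cf fd ft d0 tb fb nz; rewrite lt_neqAle eq_sym d0 leNgt; apply/negP => dn.
have fdN : is_derive t 1 (- f) (- d) by exact: is_deriveN.
have [|||_ [x /andP[tx xt] fx]] := is_derive_near fdN _ _ (e := b - t);
  rewrite ?oppr_gt0 ?fctE ?ft ?oppr0 //; first lra.
have : 0 < f x; last by move: fx; rewrite /= opprfctE; lra.
apply: no_zero_pos_left fb _ => // [|y /andP[xy yb]]; first lra.
by apply: nz; rewrite yb andbT; lra.
Qed.

End RealFunctions.

Section Curves.
Variable R : realType.
Implicit Types (c : R -> R * R) (p q : R * R) (a b s t e l : R).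

(** The lines of the moves are zero sets of such forms, which turns crossings with them into zeros
    of a real function. *)
Definition linform a b p : R := a * p.1 + b * p.2.

Lemma is_derive_linform c a b s : differentiable c s ->
  is_derive s 1 (fun t => linform a b (c t)) (linform a b (c^`() s)).
Proof.
move=> dc.
have d1 : differentiable (fst : R * R -> R) (c s).
  by apply: linear_differentiable => p; exact: cvg_fst.
have d2 : differentiable (snd : R * R -> R) (c s).
  by apply: linear_differentiable => p; exact: cvg_snd.
have D1 : is_derive s 1 (fun t => (c t).1) (c^`() s).1.
  split; first exact/diff_derivable/(differentiable_comp dc d1).
  rewrite deriveE; last exact: (differentiable_comp dc d1).
  rewrite (diff_comp dc d1) /= derive1E' // diff_lin // => p; exact: cvg_fst.
have D2 : is_derive s 1 (fun t => (c t).2) (c^`() s).2.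
  split; first exact/diff_derivable/(differentiable_comp dc d2).
  rewrite deriveE; last exact: (differentiable_comp dc d2).
  rewrite (diff_comp dc d2) /= derive1E' // diff_lin // => p; exact: cvg_snd.
exact: (is_deriveD (is_deriveZ a D1) (is_deriveZ b D2)).
Qed.

Lemma smooth_differentiable (V W : normedModType R) (f : V -> W) (v : V) :
  smooth f -> differentiable f v.
Proof. by move=> /(_ [::]) /(_ v). Qed.

Lemma smooth_continuous (V W : normedModType R) (f : V -> W) :
  smooth f -> continuous f.
Proof. by move=> sf v; exact/differentiable_continuous/smooth_differentiable. Qed.

Lemma smooth_derive (V W : normedModType R) (f : V -> W) v :
  smooth f -> smooth ('D_v f).
Proof. by move=> sf vs w; have := sf (rcons vs v) w; rewrite foldr_rcons. Qed.

Lemma continuous_linform (T : topologicalType) (f : T -> R * R) a b : continuous f ->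
  continuous (fun x : T => linform a b (f x)).
Proof.
move=> cf x; apply: cvgD; apply: cvgM; try exact: cvg_cst.
  exact: (@continuous_comp _ _ _ f fst x (cf x) (@cvg_fst _ _ _ _ _)).
exact: (@continuous_comp _ _ _ f snd x (cf x) (@cvg_snd _ _ _ _ _)).
Qed.

(** A nonzero derivative forces nonzero values arbitrarily close to t on both sides, and at least
    one side lies in the interval, even if t is an endpoint. *)
Lemma derive_eq0_itv (f : R -> R) a b t d : is_derive t 1 f d -> a < b ->
  a <= t <= b -> (forall s, a <= s <= b -> f s = 0) -> d = 0.
Proof.
move=> fd ab /andP[at' tb] f0; apply/eqP; apply: contraT => d0.
wlog dp : f d fd f0 d0 / 0 < d.
  move=> h; have [dp|dn] := ltP 0 d; first exact: h fd f0 d0 dp.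
  have fdN : is_derive t 1 (- f) (- d) by exact: is_deriveN.
  apply: h fdN _ _ _; rewrite ?oppr_eq0 // ?oppr_gt0 ?lt_neqAle ?d0 //.
  by move=> s sab; rewrite opprfctE f0 ?oppr0.
have ft : f t = 0 by rewrite f0 // at' tb.
have [tLb|bLt] := ltP t b.
  have [|_ [x /andP[tx xb]]] := is_derive_near fd dp ft (e := b - t); first lra.
  by rewrite f0 ?ltxx //; apply/andP; split; lra.
have [|[x /andP[tx xb]] + _] := is_derive_near fd dp ft (e := t - a); first lra.
by rewrite f0 ?ltxx //; apply/andP; split; lra.
Qed.

(** The curves of a move are assumed equal only off the closed moving strand; continuity extends the
    equality to its first endpoint. *)
Lemma eq_left_limit (V : normedModType R) (f g : R -> V) l a :
  continuous f -> continuous g ->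
  l < a -> (forall s, l < s < a -> f s = g s) -> f a = g a.
Proof.
move=> cf cg la fg.
have fa : f s @[s --> a^'-] --> f a by apply: cvg_at_left_filter; exact: cf.
have ga : g s @[s --> a^'-] --> g a by apply: cvg_at_left_filter; exact: cg.
apply: (cvg_unique (@norm_hausdorff _ _) fa).
apply: cvg_trans ga; apply: near_eq_cvg; near=> s; apply/esym/fg.
by apply/andP; split; near: s; [exact: nbhs_left_gt|exact: nbhs_left_lt].
Unshelve. all: by end_near. Qed.

Lemma eq_right_limit (V : normedModType R) (f g : R -> V) l a :
  continuous f -> continuous g ->
  a < l -> (forall s, a < s < l -> f s = g s) -> f a = g a.
Proof.
move=> cf cg la fg.
have fa : f s @[s --> a^'+] --> f a by apply: cvg_at_right_filter; exact: cf.
have ga : g s @[s --> a^'+] --> g a by apply: cvg_at_right_filter; exact: cg.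
apply: (cvg_unique (@norm_hausdorff _ _) fa).
apply: cvg_trans ga; apply: near_eq_cvg; near=> s; apply/esym/fg.
by apply/andP; split; near: s; [exact: nbhs_right_gt|exact: nbhs_right_lt].
Unshelve. all: by end_near. Qed.

Lemma eq_derive1_near (c c' : R -> R * R) s e :
  0 < e -> (forall t, s - e < t < s + e -> c t = c' t) -> c^`() s = c'^`() s.
Proof.
move=> e0 cc'; rewrite !derive1E; apply: near_eq_derive; near=> t.
apply: cc'; rewrite -ltr_distlC; near: t.
exact: cvgr_dist_lt.
Unshelve. all: by end_near. Qed.

End Curves.

(** * The first Reidemeister move *)

Section Crossings.
Variable R : realType.
Implicit Types (c e : R * R) (D : diagram R) (s t a b : R) (L : seq (R * R)).

Definition distinct_params L : bool := uniq (unzip1 L ++ unzip2 L).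

Lemma distinct_params_perm L1 L2 :
  perm_eq L1 L2 -> distinct_params L1 = distinct_params L2.
Proof.
move=> p; apply: perm_uniq.
exact: perm_cat (perm_map _ p) (perm_map _ p).
Qed.

Lemma uniq_map_inj (T T' : eqType) (f : T -> T') (L : seq T) :
  uniq (map f L) -> {in L &, injective f}.
Proof.
move=> u x y xL yL fxy; have [i iL xi] := nthP x xL; have [j jL yj] := nthP x yL.
suff ij : i = j by rewrite -xi ij yj.
apply: (uniqP (f x) u); rewrite ?inE ?size_map //.
by rewrite !(nth_map x) // xi yj.
Qed.

Lemma distinct_paramsP L c e : distinct_params L -> c \in L -> e \in L -> c != e ->
  uniq [:: c.1; c.2; e.1; e.2].
Proof.
rewrite /distinct_params cat_uniq => /and3P[u1 /hasPn dis u2] cL eL ce.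
have neq x y : x \in L -> y \in L -> x.1 != y.2.
  move=> xL yL; apply/eqP => xy; have := dis y.2 (map_f _ yL).
  by rewrite /= -xy map_f.
rewrite /= !inE !negb_or !neq // [c.2 == _]eq_sym neq //=.
rewrite !andbT; apply/andP; split; apply: contra_neq ce => ce.
  exact: (uniq_map_inj u1).
exact: (uniq_map_inj u2).
Qed.

Lemma distinct_params_neq L c : distinct_params L -> c \in L -> c.1 != c.2.
Proof.
rewrite /distinct_params cat_uniq => /and3P[_ /hasPn dis _] cL; apply/eqP => cc.
by have := dis c.2 (map_f _ cL); rewrite /= -cc map_f.
Qed.

Lemma sgz_antisym s t : sgz (s - t) = - sgz (t - s).
Proof. by rewrite -sgzN opprB. Qed.

Lemma inter_antisym c e : uniq [:: c.1; c.2; e.1; e.2] ->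
  inter e c = - inter c e.
Proof.
move=> u; have u' : uniq [:: e.1; e.2; c.1; c.2].
  by have := rot_uniq 2 [:: c.1; c.2; e.1; e.2]; rewrite u.
have := interE u; have := interE u'.
rewrite (sgz_antisym e.2 c.2) (sgz_antisym e.1 c.2).
rewrite (sgz_antisym e.2 c.1) (sgz_antisym e.1 c.1); lia.
Qed.

Definition bsgn (o : bool) : int := if o then 1 else -1.

Lemma bsgn_is_sign o : is_sign (bsgn o).
Proof. by case: o; [left|right]. Qed.

Lemma uniq_mk o1 o2 s t s' t' : uniq [:: s; t; s'; t'] ->
  uniq [:: (mkcrossing o1 s t).1; (mkcrossing o1 s t).2;
           (mkcrossing o2 s' t').1; (mkcrossing o2 s' t').2].
Proof.
rewrite /= !inE !negb_or => /and4P[/and3P[n1 n2 n3] /andP[n4 n5] n6 _].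
by case: o1; case: o2; rewrite /= ?(eq_sym t s) ?(eq_sym t' s') n1 n2 n3 n4 n5 n6.
Qed.

(** Reversing a chord only changes the sign of its intersection numbers, so the over/under
    information factors out and the bracket sees only the parameters. *)
Lemma inter_mk o1 o2 s t s' t' : uniq [:: s; t; s'; t'] ->
  inter (mkcrossing o1 s t) (mkcrossing o2 s' t') *+ 2 =
  bsgn o1 * bsgn o2 *
    (sgz (t - t') - sgz (s - t') - sgz (t - s') + sgz (s - s')).
Proof.
move=> u; rewrite interE; last exact: uniq_mk.
by case: o1; case: o2 => /=; lia.
Qed.

(** The strand is closed, so s has a neighbourhood avoiding it. The radius is also bounded by the
    distances to 0 and 1, since the curves are compared on the unit interval only. *)
Lemma eq_derive1_outside D D' (I : pred R) a b s :
    local_move D D' I (strand a b) -> 0 < s < 1 -> ~~ strand a b s ->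
  D^`() s = D'^`() s.
Proof.
move=> [_ _ agree] /andP[s0 s1] sab.
have [e e0 he] : exists2 e, 0 < e &
    forall t, s - e < t < s + e -> 0 < t < 1 /\ ~~ strand a b t.
  have : s < a \/ b < s.
    by move: sab; rewrite /strand negb_and -!ltNge => /orP.
  case=> h.
    exists (Num.min (Num.min s (1 - s)) (a - s)).
      by rewrite !lt_min s0 !subr_gt0 s1 h.
    move=> t; rewrite -ltr_distlC !lt_min => /andP[/andP[]].
    rewrite !ltr_distlC !addrA /strand negb_and -!ltNge => h1 h2 h3.
    by split; [|apply/orP; left]; lra.
  exists (Num.min (Num.min s (1 - s)) (s - b)).
    by rewrite !lt_min s0 !subr_gt0 s1 h.
  move=> t; rewrite -ltr_distlC !lt_min => /andP[/andP[]].
  rewrite !ltr_distlC !addrA /strand negb_and -!ltNge => h1 h2 h3.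
  by split; [|apply/orP; right]; lra.
apply: (eq_derive1_near e0) => t /he[t01 tab].
by apply: agree => //; rewrite inE /= in_itv /=; lra.
Qed.

Lemma crossing_sign_outside D D' (I : pred R) a b c :
    local_move D D' I (strand a b) -> (0 < c.1 < 1) && (0 < c.2 < 1) ->
    ~~ strand a b c.1 -> ~~ strand a b c.2 ->
  crossing_sign D c = crossing_sign D' c.
Proof.
move=> mv /andP[c1 c2] h1 h2.
by rewrite /crossing_sign !(eq_derive1_outside mv).
Qed.

Lemma crossing_sign_det D c :
  crossing_sign D c = if 0 < det2 (D^`() c.1) (D^`() c.2) then 1 else -1.
Proof. by []. Qed.

(** This makes intersection numbers with crossings outside the square depend on the strands only,
    not on the positions along them. *)
Lemma strand_sgz a b s t u : strand a b s -> strand a b t -> ~~ strand a b u ->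
  sgz (s - u) = sgz (t - u).
Proof.
rewrite /strand => /andP[h1 h2] /andP[h3 h4]; rewrite negb_and -!ltNge => /orP[h|h].
  by rewrite !gtr0_sgz // subr_gt0; lra.
by rewrite !ltr0_sgz // subr_lt0; lra.
Qed.

(** Both ends of the new chord lie on an interval that contains no other end, so the chord is
    isolated. *)
Lemma reidemeister1_Hcoef D D' n : reidemeister1 D D' -> Hcoef D' n = Hcoef D n.
Proof.
case=> a [b [s [t [ab mv [As At] free perm]]]].
have sep : distinct_params ((s, t) :: crossings D).
  by rewrite -(distinct_params_perm perm); exact: crossings_uniq.
apply: (etrans (wcoef_perm _ _ _ perm)).
have far e : e \in crossings D -> ~~ strand a b e.1 /\ ~~ strand a b e.2.
  by move=> eD; have /andP[] := allP free e eD.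
have st e : e \in crossings D -> uniq [:: s; t; e.1; e.2].
  move=> eD; apply: (@distinct_paramsP _ (s, t) e sep); rewrite ?inE ?eqxx ?eD ?orbT //.
  by apply/eqP => est; have [+ _] := far e eD; rewrite -est /= As.
have ist e : e \in crossings D -> inter (s, t) e = 0.
  move=> eD; suff : inter (s, t) e *+ 2 = 0 by lia.
  have [h1 h2] := far e eD.
  rewrite interE; last exact: st.
  rewrite /= (strand_sgz At As h1) (strand_sgz At As h2); lia.
have isol : {in crossings D, forall e, inter (s, t) e = 0 /\ inter e (s, t) = 0}.
  move=> e eD; rewrite (@inter_antisym (s, t) e (st e eD)) (ist e eD).
  by rewrite oppr0.
apply: (etrans (@wcoef_isolated _ _ _ _ _ n (inter_self _) isol)).
apply: wcoef_ext => [e e' _ _|e eD]; first by [].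
have [h1 h2] := far e eD; symmetry.
exact: crossing_sign_outside mv (crossings_inner eD) h1 h2.
Qed.

End Crossings.

(** * Strands along lines *)

Section Strands.
Variable R : realType.
Implicit Types (D : diagram R) (I : pred R) (a b c d k l r s t u : R).

Lemma mem_unit_itv s : 0 <= s <= 1 -> s \in `[0, 1].
Proof. by move=> h; rewrite inE /= in_itv. Qed.

Lemma disjoint_strandsP a b c d : a < b -> c < d ->
  disjoint_strands (strand a b) (strand c d) -> b < c \/ d < a.
Proof.
move=> ab cd dis; have [bc|cb] := ltP b c; first by left.
have [da|ad] := ltP d a; first by right.
have := dis (Num.max a c).
by rewrite /strand !le_max !lexx !ge_max ad cb (ltW ab) (ltW cd) orbT.
Qed.

(** In a move, the parameters just before a are thus outside the square, which will put the point of
    parameter a on its boundary. *)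
Lemma strand_gap_left a b c d : 0 < a -> a < b -> c < d ->
    disjoint_strands (strand a b) (strand c d) ->
  exists2 l, 0 <= l < a & forall s, l < s < a -> ~~ strand c d s.
Proof.
move=> a0 ab cd /(disjoint_strandsP ab cd)[bc|da].
  exists 0; first by rewrite lexx.
  by move=> s /andP[_ sa]; rewrite /strand negb_and -!ltNge; apply/orP; left; lra.
exists (Num.max 0 d); first by rewrite le_max lexx gt_max a0 da.
move=> s; rewrite gt_max -andbA => /and3P[_ ds _].
by rewrite /strand negb_and -!ltNge ds orbT.
Qed.

Lemma strand_gap_right a b c d : a < b -> b < 1 -> c < d ->
    disjoint_strands (strand a b) (strand c d) ->
  exists2 r, b < r <= 1 & forall s, b < s < r -> ~~ strand c d s.
Proof.
move=> ab b1 cd /(disjoint_strandsP ab cd)[bc|da].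
  exists (Num.min 1 c); first by rewrite ge_min lexx lt_min b1 bc.
  move=> s; rewrite lt_min => /and3P[_ _ ds].
  by rewrite /strand negb_and -!ltNge ds.
exists 1; first by rewrite lexx andbT.
by move=> s /andP[bs _]; rewrite /strand negb_and -!ltNge; apply/orP; right; lra.
Qed.

Lemma monotone_itv (f df : R -> R) a b : (forall t, is_derive t 1 f (df t)) ->
    continuous df -> a < b -> (forall t, strand a b t -> df t != 0) -> 0 < df a ->
  (forall t, strand a b t -> 0 < df t) /\
  (forall t u, strand a b t -> strand a b u -> sgz (t - u) = sgz (f t - f u)).
Proof.
move=> fd cdf ab nz da.
have pos t : strand a b t -> 0 < df t.
  move=> /andP[at' tb]; apply: no_zero_pos cdf at' da _ => x /andP[ax xt].
  by apply: nz; rewrite /strand ax; lra.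
have mono t u : strand a b t -> strand a b u -> t < u -> f t < f u.
  move=> tab uab; apply: (@gtr0_derive1_lt_cc R f a b); rewrite ?in_itv //=.
  - move=> x /andP[ax xb]; rewrite derive1E (@derive_val _ _ _ _ _ _ _ (fd x)).
    by apply: pos; rewrite /strand !ltW.
  - apply: continuous_subspaceT => x; apply: differentiable_continuous.
    by apply/derivable1_diffP.
split=> // t u tab uab; case: (ltgtP t u) => tu.
- by rewrite !ltr0_sgz // subr_lt0 // mono.
- by rewrite !gtr0_sgz // subr_gt0 // mono.
- by rewrite tu !subrr.
Qed.

(** The velocity is tangent to the line and nonzero, so its first coordinate never vanishes and has
    a constant sign [beta]: the strand runs along the line monotonically. *)
Lemma line_direction D a b k : 0 <= a -> a < b -> b <= 1 ->
    (forall s, strand a b s -> (D s).2 = k * (D s).1) ->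
  exists beta, [/\ is_sign beta,
    forall t, strand a b t -> sgz (D^`() t).1 = beta /\
      (D^`() t).2 = k * (D^`() t).1
  & forall t u, strand a b t -> strand a b u ->
      sgz (t - u) = beta * sgz ((D t).1 - (D u).1)].
Proof.
move=> a0 ab b1 line; have sD := curve_smooth D.
have dD (x y t : R) := is_derive_linform x y (smooth_differentiable t sD).
have slope t : strand a b t -> (D^`() t).2 = k * (D^`() t).1.
  move=> tab; suff : linform (- k) 1 (D^`() t) = 0 by rewrite /linform; lra.
  apply: (derive_eq0_itv (dD _ _ t) ab tab) => s /line.
  by rewrite /linform => ->; lra.
have nz t : strand a b t -> (D^`() t).1 != 0.
  move=> tab; have /andP[at' tb] := tab; apply/eqP => d1.
  have /eqP[] : D^`() t != 0 by apply/curve_immersed/mem_unit_itv; lra.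
  by rewrite [LHS]surjective_pairing (slope t tab) d1 mulr0.
have cD : continuous (D^`()).
  have -> : D^`() = 'D_1 D by apply/funext => t; rewrite derive1E.
  exact/smooth_continuous/smooth_derive.
have aab : strand a b a by rewrite /strand lexx ltW.
have [pa|na] := ltP 0 (D^`() a).1.
  have h t : linform 1 0 (D^`() t) = (D^`() t).1 by rewrite /linform mul1r mul0r addr0.
  have [||pos mono] := monotone_itv (dD 1 0) (continuous_linform cD) ab.
  - by move=> t /nz; rewrite h.
  - by rewrite h.
  exists 1; split; [by left| |].
    move=> t tab; split; last exact: slope.
    by have := pos t tab; rewrite h => /gtr0_sgz.
  move=> t u tab uab; rewrite mul1r (mono t u tab uab) /linform !mul1r !mul0r.
  by rewrite !addr0.
have {}na : (D^`() a).1 < 0 by rewrite lt_neqAle nz.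
have h t : linform (-1) 0 (D^`() t) = - (D^`() t).1.
  by rewrite /linform mulN1r mul0r addr0.
have [||pos mono] := monotone_itv (dD (-1) 0) (continuous_linform cD) ab.
- by move=> t /nz; rewrite h oppr_eq0.
- by rewrite h oppr_gt0.
exists (-1); split; [by right| |].
  move=> t tab; split; last exact: slope.
  by have := pos t tab; rewrite h oppr_gt0 => /ltr0_sgz.
move=> t u tab uab; rewrite mulN1r -sgzN (mono t u tab uab) /linform.
by rewrite !mulN1r !mul0r !addr0 opprB opprK addrC.
Qed.

(** Just outside [a, b] the curve is outside the square, so both ends have first coordinate 1 or -1.
    They are distinct points, hence at opposite sides, and the intermediate value theorem
    applies. *)
Lemma line_cover D I a b k l r : in_square D I ->
    0 <= l < a -> a < b -> b < r <= 1 ->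
    (forall s, l < s < a -> ~~ I s) -> (forall s, b < s < r -> ~~ I s) ->
    (forall s, strand a b s -> I s) -> `|k| <= 1 ->
    (forall s, strand a b s -> (D s).2 = k * (D s).1) ->
    (a, b) \notin crossings D -> (b, a) \notin crossings D ->
  forall p, square p -> p.2 = k * p.1 -> exists2 t, strand a b t & D t = p.
Proof.
move=> sq /andP[l0 la] ab /andP[br r1] gapl gapr inI k1 line nab nba.
have cD := smooth_continuous (curve_smooth D).
have aab : strand a b a by rewrite /strand lexx ltW.
have bab : strand a b b by rewrite /strand lexx ltW.
have near_open x : `|(D x).1| < 1 -> `|(D x).2| < 1 ->
    \forall s \near x, square (D s).
  move=> x1 x2.
  have c1 : (D s).1 @[s --> x] --> (D x).1.
    exact: (@continuous_comp _ _ _ D fst x (cD x) (@cvg_fst _ _ _ _ _)).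
  have c2 : (D s).2 @[s --> x] --> (D x).2.
    exact: (@continuous_comp _ _ _ D snd x (cD x) (@cvg_snd _ _ _ _ _)).
  have n1 := cvgr_norm_le _ c1 _ x1; have n2 := cvgr_norm_le _ c2 _ x2.
  by near=> s; rewrite /square; apply/andP; split; near: s; [exact: n1|exact: n2].
have bnd s : strand a b s -> `|(D s).1| <= 1.
  move=> sab; have /andP[] // : square (D s).
  by rewrite sq ?inI //; apply: mem_unit_itv; move: sab; rewrite /strand; lra.
(* As |k| is at most 1, the line leaves the square through its vertical sides, and only the first
   coordinate has to be watched. *)
have lt2 s : strand a b s -> `|(D s).1| < 1 -> `|(D s).2| < 1.
  move=> sab h; rewrite line // normrM; apply: le_lt_trans h.
  by rewrite -[leRHS]mul1r ler_wpM2r.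
have unit_ab s : strand a b s -> s \in `[0, 1].
  by move=> /andP[h1 h2]; apply: mem_unit_itv; lra.
have enda : `|(D a).1| = 1.
  apply/eqP; rewrite eq_le bnd //= leNgt; apply/negP => h.
  have ha : \forall s \near a^'-, square (D s).
    exact/cvg_within/(near_open a h (lt2 a aab h)).
  near a^'- => s.
  have sl : l < s < a.
    by apply/andP; split; near: s; [exact: nbhs_left_gt|exact: nbhs_left_lt].
  have : square (D s) by near: s.
  by rewrite sq ?(negbTE (gapl s sl)) //; apply: mem_unit_itv; lra.
have endb : `|(D b).1| = 1.
  apply/eqP; rewrite eq_le bnd //= leNgt; apply/negP => h.
  have hb : \forall s \near b^'+, square (D s).
    exact/cvg_within/(near_open b h (lt2 b bab h)).
  near b^'+ => s.
  have sl : b < s < r.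
    by apply/andP; split; near: s; [exact: nbhs_right_gt|exact: nbhs_right_lt].
  have : square (D s) by near: s.
  by rewrite sq ?(negbTE (gapr s sl)) //; apply: mem_unit_itv; lra.
(* Equal first coordinates would give equal points on the line, and a and b would form a
   crossing. *)
have Dab : (D a).1 != (D b).1.
  apply/eqP => Dab; have eDab : D a = D b.
    by rewrite [LHS]surjective_pairing [RHS]surjective_pairing !line // Dab.
  have anb : a != b by rewrite lt_eqF.
  have := @crossings_double _ D a b (unit_ab a aab) (unit_ab b bab) anb.
  by case=> /(_ eDab) [] h _; [move: nab|move: nba]; rewrite h.
move=> p /andP[p1 p2] pk.
have [||t tab tp] := @IVT R (fun s => (D s).1) a b p.1 (ltW ab).
- apply: continuous_subspaceT => x.
  exact: (@continuous_comp _ _ _ D fst x (cD x) (@cvg_fst _ _ _ _ _)).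
- move: p1; rewrite ler_norml.
  move: enda endb Dab; do 2 (move=> /eqP; rewrite eqr_norml => /andP[/orP[]/eqP -> _]);
    rewrite ?eqxx //= => _ /andP[q1 q2]; rewrite ge_min le_max q1 q2 ?orbT //.
exists t; first by move: tab; rewrite in_itv.
rewrite [LHS]surjective_pairing [RHS]surjective_pairing line; last first.
  by move: tab; rewrite in_itv.
by rewrite pk tp.
Unshelve. all: by end_near. Qed.

End Strands.

(** * The second Reidemeister move *)

Section SecondMove.
Variable R : realType.
Implicit Types (D : diagram R) (I : pred R) (a b c d s t : R) (e : R * R)
  (L : seq (R * R)).

Lemma det2_opp (v w : R * R) : det2 w v = - det2 v w.
Proof. by rewrite /det2 opprB [w.1 * _]mulrC [w.2 * _]mulrC. Qed.

Lemma crossing_sign_mk D o s t : det2 (D^`() s) (D^`() t) != 0 ->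
  crossing_sign D (mkcrossing o s t) = bsgn o * sgz (det2 (D^`() s) (D^`() t)).
Proof.
rewrite crossing_sign_det; case: o => /=; move: (D^`() s) (D^`() t) => v w d0.
  case: ltgtP d0 => // h _; first by rewrite gtr0_sgz.
  by rewrite ltr0_sgz.
rewrite (det2_opp v w) oppr_gt0; case: ltgtP d0 => // h _; first by rewrite ltr0_sgz.
by rewrite gtr0_sgz.
Qed.

Lemma mkcrossingK o s t : mkcrossing o (mkcrossing o s t).1 (mkcrossing o s t).2 = (s, t).
Proof. by case: o. Qed.

Lemma distinct_params_mk L o1 o2 s t s' t' :
  distinct_params [:: mkcrossing o1 s t, mkcrossing o2 s' t' & L] ->
  uniq [:: s; t; s'; t'].
Proof.
move=> sep; have := distinct_paramsP sep (mem_head _ _) (_ : mkcrossing o2 s' t' \in _).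
move=> /(_ _ _)/(uniq_mk o1 o2); rewrite !mkcrossingK; apply.
  by rewrite !inE eqxx orbT.
apply: contraTneq sep => ->.
by rewrite /distinct_params /= inE eqxx.
Qed.

(** Between positive end values, f must decrease through its first zero and increase through its
    second one. *)
Lemma sgz_two_zeros (f : R -> R) a b t1 t2 (d1 d2 : R) : continuous f ->
    is_derive t1 1 f d1 -> is_derive t2 1 f d2 -> d1 != 0 -> d2 != 0 ->
    0 < f a -> 0 < f b -> strand a b t1 -> strand a b t2 -> t1 != t2 ->
    f t1 = 0 -> f t2 = 0 ->
    (forall t, strand a b t -> f t = 0 -> t = t1 \/ t = t2) ->
  sgz d2 = - sgz d1.
Proof.
move=> cf; wlog t12 : t1 t2 d1 d2 / t1 < t2.
  move=> wl f1 f2 n1 n2 fa fb h1 h2 t12 z1 z2 h.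
  have /orP[lt12|lt21] : (t1 < t2) || (t2 < t1) by rewrite -neq_lt.
    exact: (wl t1 t2 d1 d2).
  rewrite (wl t2 t1 d2 d1) ?opprK // 1?eq_sym // => t th ft.
  by case: (h t th ft); [right|left].
move=> f1 f2 n1 n2 fa fb /andP[at1 t1b] /andP[at2 t2b] _ z1 z2 h.
have at1' : a < t1.
  by rewrite lt_neqAle at1 andbT; apply: contraTneq fa => ->; rewrite z1 ltxx.
have t2b' : t2 < b.
  by rewrite lt_neqAle t2b andbT; apply: contraTneq fb => <-; rewrite z2 ltxx.
rewrite [in RHS]ltr0_sgz ?gtr0_sgz ?opprK //.
  apply: (derive_gt0_right cf f2 z2 n2 t2b' fb) => t /andP[tt tb].
  by apply/eqP => /h[|tE|tE]; [rewrite /strand; lra|lra|lra].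
apply: (derive_lt0_left cf f1 z1 n1 at1' fa) => t /andP[at' tt].
by apply/eqP => /h[|tE|tE]; [rewrite /strand; lra|lra|lra].
Qed.

(** The height of B above the axis has exactly two zeros, with opposite slopes, while A keeps its
    direction: the two signs are opposite and [wcoef_cancel] applies. *)
Lemma reidemeister2_Hcoef D D' n : reidemeister2 D D' -> Hcoef D' n = Hcoef D n.
Proof.
case=> a [b [c [d [s1 [s2 [t1 [t2 [ov]]]]]]]].
move=> [[pA pB dis] mv [lineA posB] [As1 As2 Bt1 Bt2] [free perm]].
have [/and3P[a0 ab b1] /and3P[c0 cd d1]] := (pA, pB).
have [sqD sqD' agree] := mv.
set A := strand a b in As1 As2 lineA dis free mv sqD sqD'.
set B := strand c d in Bt1 Bt2 posB dis free mv sqD sqD' agree.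
have sep : distinct_params [:: mkcrossing ov s1 t1, mkcrossing ov s2 t2 & crossings D].
  by rewrite -(distinct_params_perm perm); exact: crossings_uniq.
have AnB s : A s -> ~~ B s by move=> As; have := dis s; rewrite As.
have BnA s : B s -> ~~ A s by move=> Bs; have := dis s; rewrite Bs andbT.
have inA s : A s -> s \in `[0, 1].
  by move=> /andP[h1 h2]; apply: mem_unit_itv; lra.
have inB s : B s -> s \in `[0, 1].
  by move=> /andP[h1 h2]; apply: mem_unit_itv; lra.
have far e : e \in crossings D -> [/\ ~~ A e.1, ~~ B e.1, ~~ A e.2 & ~~ B e.2].
  move=> eD; have /andP[] := allP free e eD; rewrite /= !negb_or.
  by move=> /andP[-> ->] /andP[-> ->].
have lineD s : A s -> (D s).2 = 0 * (D s).1 by move=> /lineA ->; rewrite mul0r.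
have DD' s : A s -> D s = D' s by move=> As; apply: agree; [exact: inA|exact: AnB].
have aA : A a by rewrite /A /strand lexx ltW.
have [l la gapl] := strand_gap_left a0 ab cd dis.
have [r br gapr] := strand_gap_right ab b1 cd dis.
have cover p : square p -> p.2 = 0 * p.1 -> exists2 t, A t & D t = p.
  apply: (line_cover sqD la ab br) => //.
  - move=> s sl; rewrite /= negb_or (gapl s sl) andbT /A /strand negb_and -!ltNge.
    by apply/orP; left; lra.
  - move=> s sl; rewrite /= negb_or (gapr s sl) andbT /A /strand negb_and -!ltNge.
    by apply/orP; right; lra.
  - by move=> s; rewrite /= -/A => ->.
  - by rewrite normr0.
  - by apply/negP => /far[]; rewrite aA.
  - by apply/negP => /far[_ _]; rewrite aA.
pose f t := linform 0 1 (D' t).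
have fE t : f t = (D' t).2 by rewrite /f /linform mul0r mul1r add0r.
have xD' : mkcrossing ov s1 t1 \in crossings D' by rewrite (perm_mem perm) inE eqxx.
have yD' : mkcrossing ov s2 t2 \in crossings D'.
  by rewrite (perm_mem perm) !inE eqxx orbT.
have meet s t : A s -> B t -> mkcrossing ov s t \in crossings D' -> D' s = D' t.
  move=> As Bt st; have snt : s != t by apply: contraTneq Bt => <-; exact: AnB.
  apply/(@crossings_double _ D' s t (inA s As) (inB t Bt) snt).
  by case: (ov) st => /= st; [left|right].
have zero s t : A s -> B t -> mkcrossing ov s t \in crossings D' -> f t = 0.
  by move=> As Bt st; rewrite fE -(meet s t) // -DD' // lineA.
(* A zero gives a point of the axis inside the square, which A covers, hence a crossing of A with B;
   the old crossings avoid both strands. *)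
have zeros t : B t -> f t = 0 -> t = t1 \/ t = t2.
  move=> Bt; rewrite fE => ft.
  have [||s As st] := cover (D' t).
  - by rewrite sqD' ?inB //= -/B Bt orbT.
  - by rewrite ft mul0r.
  have snt : s != t by apply: contraTneq Bt => <-; exact: AnB.
  have in_list u v : A u -> B v ->
      (u, v) \in crossings D' \/ (v, u) \in crossings D' -> v = t1 \/ v = t2.
    move=> Au Bv; have Avn := BnA v Bv; have Bun := AnB u Au.
    have u1 : u != t1 by apply: contraTneq Bt1 => <-.
    have u2 : u != t2 by apply: contraTneq Bt2 => <-.
    have v1 : v != s1 by apply: contraTneq As1 => <-.
    have v2 : v != s2 by apply: contraTneq As2 => <-.
    rewrite !(perm_mem perm) !inE /mkcrossing.
    case=> /or3P[/eqP|/eqP|/far[/= h1 h2 h3 h4]];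
      try by move: Au Bv; rewrite ?(negbTE h1) ?(negbTE h2).
    + by case: (ov) => -[h h']; [left|move: u1; rewrite h eqxx].
    + by case: (ov) => -[h h']; [right|move: u2; rewrite h eqxx].
    + by case: (ov) => -[h h']; [move: v1; rewrite h eqxx|left].
    + by case: (ov) => -[h h']; [move: v2; rewrite h eqxx|right].
  apply: (in_list s) => //.
  by apply/(@crossings_double _ D' s t (inA s As) (inB t Bt) snt); rewrite -DD' // st.
have lineD' s : A s -> (D' s).2 = 0 * (D' s).1.
  by move=> As; rewrite -DD' // lineD.
have [beta [hbeta dirA _]] := line_direction (ltW a0) ab (ltW b1) lineD'.
have sD' := curve_smooth D'.
have cD' := smooth_continuous sD'.
have [v vE] : exists v, v = D'^`() by exists (D'^`()).
rewrite -vE in dirA.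
have fd t : is_derive t 1 f (v t).2.
  have -> : (v t).2 = linform 0 1 (v t) by rewrite /linform mul0r mul1r add0r.
  by rewrite vE; exact: is_derive_linform (smooth_differentiable t sD').
have detE s t : A s -> det2 (v s) (v t) = (v s).1 * (v t).2.
  by move=> As; rewrite /det2 (dirA s As).2 !mul0r subr0.
have trans s t : A s -> mkcrossing ov s t \in crossings D' ->
    (v s).1 * (v t).2 != 0.
  move=> As st; rewrite -detE //.
  have := crossings_transverse st; rewrite -vE; case: (ov) => //=.
  by rewrite det2_opp oppr_eq0.
have sgnE s t : A s -> mkcrossing ov s t \in crossings D' ->
    crossing_sign D' (mkcrossing ov s t) = bsgn ov * (beta * sgz (v t).2).
  move=> As st; rewrite crossing_sign_mk; last by rewrite -vE detE ?trans.
  by rewrite -vE detE // sgzM (dirA s As).1.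
have u12 := distinct_params_mk sep.
(* The ends of B do not move, so B still starts and ends above the axis. *)
have fc : 0 < f c.
  rewrite fE (_ : D' c = D c).
    by apply: posB; rewrite /B /strand lexx ltW.
  apply: (@eq_left_limit _ _ _ _ 0) => //.
    exact: smooth_continuous (curve_smooth D).
  move=> s /andP[s0 sc]; rewrite agree //; first by apply: mem_unit_itv; lra.
  by rewrite /B /strand negb_and -!ltNge sc.
have fd' : 0 < f d.
  rewrite fE (_ : D' d = D d).
    by apply: posB; rewrite /B /strand lexx ltW.
  apply: (@eq_right_limit _ _ _ _ 1) => //.
    exact: smooth_continuous (curve_smooth D).
  move=> s /andP[s0 sc]; rewrite agree //; first by apply: mem_unit_itv; lra.
  by rewrite /B /strand negb_and -!ltNge s0 orbT.
have opp : crossing_sign D' (mkcrossing ov s2 t2) =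
    - crossing_sign D' (mkcrossing ov s1 t1).
  rewrite (sgnE _ _ As1 xD') (sgnE _ _ As2 yD').
  rewrite (sgz_two_zeros (continuous_linform cD') (fd t1) (fd t2) _ _ fc fd' Bt1 Bt2) //.
  - by rewrite !mulrN.
  - by have := trans _ _ As1 xD'; rewrite mulf_eq0 negb_or => /andP[].
  - by have := trans _ _ As2 yD'; rewrite mulf_eq0 negb_or => /andP[].
  - by move: u12; rewrite /= !inE !negb_or => /and4P[_ /andP[_ ->]].
  - exact: (zero s1).
  - exact: (zero s2).
apply: (etrans (wcoef_perm _ _ _ perm)).
(* The two new chords have their ends on the same two intervals, which contain no end of an old
   chord. *)
have same e : e \in crossings D ->
    inter (mkcrossing ov s1 t1) e = inter (mkcrossing ov s2 t2) e.
  move=> eD; have [h1 h2 h3 h4] := far e eD.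
  have e12 : e.1 != e.2.
    by apply: (distinct_params_neq sep); rewrite !inE eD !orbT.
  have un s t : A s -> B t -> uniq [:: s; t; e.1; e.2].
    move=> As Bt; rewrite /= !inE !negb_or e12.
    rewrite (contraTneq _ (AnB s As)) => [|->]; last by rewrite Bt.
    by do ![rewrite (contraTneq _ As) => [|->] //|rewrite (contraTneq _ Bt) => [|->] //].
  suff : inter (mkcrossing ov s1 t1) (mkcrossing true e.1 e.2) *+ 2 =
         inter (mkcrossing ov s2 t2) (mkcrossing true e.1 e.2) *+ 2.
    have -> : mkcrossing true e.1 e.2 = e by case: (e).
    exact: mulr2n_int_inj.
  rewrite !inter_mk ?un // (strand_sgz As1 As2 h1) (strand_sgz As1 As2 h3).
  by rewrite (strand_sgz Bt1 Bt2 h2) (strand_sgz Bt1 Bt2 h4).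
have inL e : e \in crossings D ->
    e \in [:: mkcrossing ov s1 t1, mkcrossing ov s2 t2 & crossings D].
  by move=> eD; rewrite !inE eD !orbT.
have anti e : e \in crossings D ->
    inter e (mkcrossing ov s1 t1) = - inter (mkcrossing ov s1 t1) e /\
    inter e (mkcrossing ov s2 t2) = - inter (mkcrossing ov s2 t2) e.
  move=> eD; have [h1 h2 h3 h4] := far e eD.
  have xe : mkcrossing ov s1 t1 != e.
    by apply: contraTneq As1 => E; move: h1 h3; rewrite -E; case: (ov).
  have ye : mkcrossing ov s2 t2 != e.
    by apply: contraTneq As2 => E; move: h1 h3; rewrite -E; case: (ov).
  split; apply: inter_antisym.
    by apply: (distinct_paramsP sep _ (inL e eD) xe); rewrite inE eqxx.
  by apply: (distinct_paramsP sep _ (inL e eD) ye); rewrite !inE eqxx orbT.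
apply: (etrans (@wcoef_cancel _ _ _ _ _ _ n (inter_self _) (inter_self _) _ opp _)).
- apply: inter_antisym; apply: uniq_mk; exact: u12.
- by move=> e eD; rewrite (anti e eD).1 (anti e eD).2 (same e eD).
apply: wcoef_ext => [e e' _ _|e eD]; first by [].
have [h1 h2 h3 h4] := far e eD; symmetry.
exact: crossing_sign_outside mv (crossings_inner eD) h2 h4.
Qed.

End SecondMove.

(** * The third Reidemeister move *)

Section ThirdMove.
Variable R : realType.
Implicit Types (D E : diagram R) (a b c d s t u : R) (e : R * R).

(** As t is the only zero, f stays positive from u to t, and its slope at t is determined by the
    side on which u lies. *)
Lemma sgz_derive_side (f : R -> R) a b t u (d : R) : continuous f ->
    is_derive t 1 f d -> f t = 0 -> d != 0 -> strand a b t -> strand a b u ->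
    0 < f u -> (forall x, strand a b x -> f x = 0 -> x = t) ->
  sgz d = sgz (u - t).
Proof.
move=> cf fd ft d0 /andP[at' tb] /andP[au ub] fu uniq_t.
have : u != t by apply: contraTneq fu => ->; rewrite ft ltxx.
rewrite neq_lt => /orP[ut|tu].
  have dn : d < 0.
    apply: (derive_lt0_left cf fd ft d0 ut fu) => x /andP[ux xt].
    apply/eqP => fx; suff xE : x = t by move: xt; rewrite xE ltxx.
    by apply: uniq_t fx; rewrite /strand; lra.
  by rewrite !ltr0_sgz // subr_lt0.
have dp : 0 < d.
  apply: (derive_gt0_right cf fd ft d0 tu fu) => x /andP[tx xu].
  apply/eqP => fx; suff xE : x = t by move: tx; rewrite xE ltxx.
  by apply: uniq_t fx; rewrite /strand; lra.
by rewrite !gtr0_sgz // subr_gt0.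
Qed.

Lemma strand_gap_left2 a b c d c' d' : 0 < a -> a < b -> c < d -> c' < d' ->
    disjoint_strands (strand a b) (strand c d) ->
    disjoint_strands (strand a b) (strand c' d') ->
  exists2 l, 0 <= l < a &
    forall s, l < s < a -> [/\ ~~ strand a b s, ~~ strand c d s & ~~ strand c' d' s].
Proof.
move=> a0 ab cd cd' dis dis'.
have [l /andP[l0 la] gap] := strand_gap_left a0 ab cd dis.
have [l' /andP[l0' la'] gap'] := strand_gap_left a0 ab cd' dis'.
exists (Num.max l l'); first by rewrite le_max l0 gt_max la la'.
move=> s; rewrite gt_max => /andP[/andP[ls ls'] sa]; split.
- by rewrite /strand negb_and -!ltNge sa.
- by apply: gap; rewrite ls.
- by apply: gap'; rewrite ls'.
Qed.

Lemma strand_gap_right2 a b c d c' d' : a < b -> b < 1 -> c < d -> c' < d' ->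
    disjoint_strands (strand a b) (strand c d) ->
    disjoint_strands (strand a b) (strand c' d') ->
  exists2 r, b < r <= 1 &
    forall s, b < s < r -> [/\ ~~ strand a b s, ~~ strand c d s & ~~ strand c' d' s].
Proof.
move=> ab b1 cd cd' dis dis'.
have [r /andP[br r1] gap] := strand_gap_right ab b1 cd dis.
have [r' /andP[br' r1'] gap'] := strand_gap_right ab b1 cd' dis'.
exists (Num.min r r'); first by rewrite ge_min r1 lt_min br br'.
move=> s; rewrite lt_min => /and3P[bs sr sr']; split.
- by rewrite /strand negb_and -!ltNge bs orbT.
- by apply: gap; rewrite bs.
- by apply: gap'; rewrite bs.
Qed.

Lemma disjoint_strands_sym (A B : pred R) :
  disjoint_strands A B -> disjoint_strands B A.
Proof. by move=> dis s; rewrite andbC. Qed.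

Lemma transverse_mk D o s t : mkcrossing o s t \in crossings D ->
  det2 (D^`() s) (D^`() t) != 0.
Proof.
move=> /crossings_transverse; case: o => /=; first by [].
by move: (D^`() s) (D^`() t) => v w; rewrite det2_opp oppr_eq0.
Qed.

(* B and C run along the diagonals of the square, A cuts both of them in its
   upper half (sigma = 1) or in its lower half (sigma = -1); beta and gamma are
   the directions of B and C. The last conclusion tells from which side A enters
   or leaves the square, which relates the two sides of a move. *)
Lemma triangle_signs E (a1 a2 b1 b2 c1 c2 sb sc tb tc ub uc sigma : R)
    (abv bcv cav : bool) (rest : seq (R * R)) :
  let A := strand a1 a2 in
  let B := strand b1 b2 in
  let C := strand c1 c2 in
  let I := predU A (predU B C) in
  let sA := sgz (sc - sb) in
  proper_strand a1 a2 -> proper_strand b1 b2 -> proper_strand c1 c2 ->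
  disjoint_strands A B -> disjoint_strands A C -> disjoint_strands B C ->
  in_square E I ->
  (forall t, B t -> (E t).2 = (E t).1) -> (forall u, C u -> (E u).2 = - (E u).1) ->
  A sb -> A sc -> B tb -> C tc -> B ub -> C uc ->
  sigma = 1 \/ sigma = -1 -> 0 < sigma * (E sb).2 -> 0 < sigma * (E sc).2 ->
  crossing_free I rest ->
  perm_eq (crossings E)
    [:: mkcrossing abv sb tb, mkcrossing cav tc sc, mkcrossing bcv ub uc & rest] ->
  exists beta gamma,
  [/\ [/\ is_sign beta, is_sign gamma & is_sign sA],
      (forall t u, B t -> B u -> sgz (t - u) = beta * sgz ((E t).1 - (E u).1)) /\
      (forall t u, C t -> C u -> sgz (t - u) = gamma * sgz ((E t).1 - (E u).1)),
      [/\ crossing_sign E (mkcrossing abv sb tb) = bsgn abv * (- (beta * sgz sigma * sA)),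
          crossing_sign E (mkcrossing bcv ub uc) = bsgn bcv * (- (beta * gamma)) &
          crossing_sign E (mkcrossing cav tc sc) = bsgn cav * (- (gamma * sgz sigma * sA))],
      sgz (tb - ub) = sgz sigma * beta /\ sgz (uc - tc) = sgz sigma * gamma
    & (sA = 1 -> 0 < sigma * ((E a1).1 + (E a1).2)) /\
      (sA = -1 -> 0 < sigma * ((E a2).1 + (E a2).2))].
Proof.
move=> A B C I sA /and3P[a10 a12 a21] /and3P[b10 b12 b21] /and3P[c10 c12 c21].
move=> disAB disAC disBC sq lineB lineC Asb Asc Btb Ctc Bub Cuc hsig sbp scp.
move=> free perm.
have AnB s : A s -> ~~ B s by move=> As; have := disAB s; rewrite As.
have AnC s : A s -> ~~ C s by move=> As; have := disAC s; rewrite As.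
have BnC s : B s -> ~~ C s by move=> Bs; have := disBC s; rewrite Bs.
have inA s : A s -> s \in `[0, 1].
  by move=> /andP[h1 h2]; apply: mem_unit_itv; lra.
have inB s : B s -> s \in `[0, 1].
  by move=> /andP[h1 h2]; apply: mem_unit_itv; lra.
have inC s : C s -> s \in `[0, 1].
  by move=> /andP[h1 h2]; apply: mem_unit_itv; lra.
have IE s : I s = [|| A s, B s | C s] by [].
have far e : e \in rest -> ~~ I e.1 /\ ~~ I e.2.
  by move=> er; have /andP[] := allP free e er.
have ABne s t : A s -> B t -> s != t.
  by move=> As Bt; apply: contraTneq Bt => <-; exact: AnB.
have ACne s t : A s -> C t -> s != t.
  by move=> As Ct; apply: contraTneq Ct => <-; exact: AnC.
have BCne s t : B s -> C t -> s != t.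
  by move=> Bs Ct; apply: contraTneq Ct => <-; exact: BnC.
have mem_list s t : I s -> I t -> (s, t) \in crossings E \/ (t, s) \in crossings E ->
   [\/ (s = sb /\ t = tb) \/ (t = sb /\ s = tb),
       (s = tc /\ t = sc) \/ (t = tc /\ s = sc) |
       (s = ub /\ t = uc) \/ (t = ub /\ s = uc)].
  move=> Is It; rewrite !(perm_mem perm) !in_cons => -[] /or4P[/eqP|/eqP|/eqP|/far[]].
  - by case: (abv) => -[-> ->]; constructor 1; [left|right].
  - by case: (cav) => -[-> ->]; constructor 2; [left|right].
  - by case: (bcv) => -[-> ->]; constructor 3; [left|right].
  - by move=> /negP.
  - by case: (abv) => -[-> ->]; constructor 1; [right|left].
  - by case: (cav) => -[-> ->]; constructor 2; [right|left].
  - by case: (bcv) => -[-> ->]; constructor 3; [right|left].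
  - by move=> /negP.
have meet o s t : s \in `[0, 1] -> t \in `[0, 1] -> s != t ->
    mkcrossing o s t \in crossings E -> E s = E t.
  move=> s01 t01 st h; apply/(@crossings_double _ E s t s01 t01 st).
  by case: o h => h; [left|right].
have xE : mkcrossing abv sb tb \in crossings E by rewrite (perm_mem perm) !inE eqxx.
have zE : mkcrossing cav tc sc \in crossings E.
  by rewrite (perm_mem perm) !inE eqxx orbT.
have yE : mkcrossing bcv ub uc \in crossings E.
  by rewrite (perm_mem perm) !inE eqxx !orbT.
have Esb : E sb = E tb := meet _ _ _ (inA _ Asb) (inB _ Btb) (ABne _ _ Asb Btb) xE.
have tsc : tc != sc by rewrite eq_sym ACne.
have Esc : E tc = E sc := meet _ _ _ (inC _ Ctc) (inA _ Asc) tsc zE.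
have Eub : E ub = E uc := meet _ _ _ (inB _ Bub) (inC _ Cuc) (BCne _ _ Bub Cuc) yE.
have Eub0 : (E ub).1 = 0.
  by have := lineB _ Bub; have := lineC _ Cuc; rewrite -Eub; lra.
have Esb1 : (E sb).1 = (E sb).2 by rewrite Esb lineB.
have Esc1 : (E sc).1 = - (E sc).2 by rewrite -Esc lineC // opprK.
have B1 : B b1 by rewrite /B /strand lexx ltW.
have B2 : B b2 by rewrite /B /strand lexx ltW.
have C1 : C c1 by rewrite /C /strand lexx ltW.
have C2 : C c2 by rewrite /C /strand lexx ltW.
(* Each listed crossing inside the square involves two different strands; in particular the ends of
   B are distinct points, as [line_cover] requires. *)
have noB s t : B s -> B t -> ~ ((s, t) \in crossings E \/ (t, s) \in crossings E).
  move=> Bs Bt; have Is : I s by rewrite IE Bs orbT.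
  have It : I t by rewrite IE Bt orbT.
  move=> /(mem_list _ _ Is It)[[[E1 _]|[E1 _]]|[[E1 _]|[E1 _]]|[[_ E1]|[_ E1]]].
  - by have := ABne _ _ Asb Bs; rewrite E1 eqxx.
  - by have := ABne _ _ Asb Bt; rewrite E1 eqxx.
  - by have := BCne _ _ Bs Ctc; rewrite E1 eqxx.
  - by have := BCne _ _ Bt Ctc; rewrite E1 eqxx.
  - by have := BCne _ _ Bt Cuc; rewrite E1 eqxx.
  - by have := BCne _ _ Bs Cuc; rewrite E1 eqxx.
have noC s t : C s -> C t -> ~ ((s, t) \in crossings E \/ (t, s) \in crossings E).
  move=> Cs Ct; have Is : I s by rewrite IE Cs !orbT.
  have It : I t by rewrite IE Ct !orbT.
  move=> /(mem_list _ _ Is It)[[[E1 _]|[E1 _]]|[[_ E1]|[_ E1]]|[[E1 _]|[E1 _]]].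
  - by have := ACne _ _ Asb Cs; rewrite E1 eqxx.
  - by have := ACne _ _ Asb Ct; rewrite E1 eqxx.
  - by have := ACne _ _ Asc Ct; rewrite E1 eqxx.
  - by have := ACne _ _ Asc Cs; rewrite E1 eqxx.
  - by have := BCne _ _ Bub Cs; rewrite E1 eqxx.
  - by have := BCne _ _ Bub Ct; rewrite E1 eqxx.
have coverB p : square p -> p.2 = p.1 -> exists2 t, B t & E t = p.
  have [l l0 gapl] :=
    strand_gap_left2 b10 b12 a12 c12 (disjoint_strands_sym disAB) disBC.
  have [r r1 gapr] :=
    strand_gap_right2 b12 b21 a12 c12 (disjoint_strands_sym disAB) disBC.
  move=> sqp pE; apply: (@line_cover _ E I b1 b2 1 l r sq l0 b12 r1) => //.
  - by move=> s /gapl[h1 h2 h3]; rewrite IE !negb_or h1 h2.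
  - by move=> s /gapr[h1 h2 h3]; rewrite IE !negb_or h1 h2.
  - by move=> s Bs; rewrite IE [B s]Bs orbT.
  - by rewrite normr1.
  - by move=> s Bs; rewrite mul1r lineB.
  - by apply/negP => h; apply: (noB b1 b2 B1 B2); left.
  - by apply/negP => h; apply: (noB b1 b2 B1 B2); right.
  - by rewrite mul1r.
have coverC p : square p -> p.2 = - p.1 -> exists2 t, C t & E t = p.
  have [l l0 gapl] := strand_gap_left2 c10 c12 a12 b12
    (disjoint_strands_sym disAC) (disjoint_strands_sym disBC).
  have [r r1 gapr] := strand_gap_right2 c12 c21 a12 b12
    (disjoint_strands_sym disAC) (disjoint_strands_sym disBC).
  move=> sqp pE; apply: (@line_cover _ E I c1 c2 (-1) l r sq l0 c12 r1) => //.
  - by move=> s /gapl[h1 h2 h3]; rewrite IE !negb_or h1 h2 h3.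
  - by move=> s /gapr[h1 h2 h3]; rewrite IE !negb_or h1 h2 h3.
  - by move=> s Cs; rewrite IE [C s]Cs !orbT.
  - by rewrite normrN1.
  - by move=> s Cs; rewrite mulN1r lineC.
  - by apply/negP => h; apply: (noC c1 c2 C1 C2); left.
  - by apply/negP => h; apply: (noC c1 c2 C1 C2); right.
  - by rewrite mulN1r.
have sqA s : A s -> square (E s) by move=> As; rewrite sq ?inA // IE As.
(* B covers its diagonal, so a point of A on this diagonal is a crossing of A with B, and only one
   is listed. *)
have zeroB s : A s -> (E s).2 = (E s).1 -> s = sb.
  move=> As Es; have [t Bt Est] := coverB _ (sqA s As) Es.
  have Is : I s by rewrite IE As.
  have It : I t by rewrite IE Bt orbT.
  have st := ABne s t As Bt.
  have /(mem_list _ _ Is It) :=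
    (@crossings_double _ E s t (inA s As) (inB t Bt) st).1 (esym Est).
  move=> [[[//]|[_ sE]]|[[sE _]|[tE _]]|[[sE _]|[_ sE]]].
  - by have := ABne _ _ As Btb; rewrite sE eqxx.
  - by have := ACne _ _ As Ctc; rewrite sE eqxx.
  - by have := BCne _ _ Bt Ctc; rewrite tE eqxx.
  - by have := ABne _ _ As Bub; rewrite sE eqxx.
  - by have := ACne _ _ As Cuc; rewrite sE eqxx.
have zeroC s : A s -> (E s).2 = - (E s).1 -> s = sc.
  move=> As Es; have [t Ct Est] := coverC _ (sqA s As) Es.
  have Is : I s by rewrite IE As.
  have It : I t by rewrite IE Ct !orbT.
  have st := ACne s t As Ct.
  have /(mem_list _ _ Is It) :=
    (@crossings_double _ E s t (inA s As) (inC t Ct) st).1 (esym Est).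
  move=> [[[_ tE]|[tE _]]|[[sE _]|[_ //]]|[[sE _]|[_ sE]]].
  - by have := BCne _ _ Btb Ct; rewrite tE eqxx.
  - by have := ACne _ _ Asb Ct; rewrite tE eqxx.
  - by have := ACne _ _ As Ctc; rewrite sE eqxx.
  - by have := ABne _ _ As Bub; rewrite sE eqxx.
  - by have := ACne _ _ As Cuc; rewrite sE eqxx.
have lineB1 s : strand b1 b2 s -> (E s).2 = 1 * (E s).1.
  by move=> /lineB; rewrite mul1r.
have lineC1 s : strand c1 c2 s -> (E s).2 = -1 * (E s).1.
  by move=> /lineC; rewrite mulN1r.
have [beta [hbeta dirB posB]] := line_direction (ltW b10) b12 (ltW b21) lineB1.
have [gamma [hgamma dirC posC]] := line_direction (ltW c10) c12 (ltW c21) lineC1.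
have trans o s t : mkcrossing o s t \in crossings E ->
  det2 (E^`() s) (E^`() t) != 0 := @transverse_mk _ _ _ _.
have sign o s t : mkcrossing o s t \in crossings E ->
    crossing_sign E (mkcrossing o s t) = bsgn o * sgz (det2 (E^`() s) (E^`() t)).
  by move=> h; rewrite (crossing_sign_mk _ (trans o s t h)).
have sE := curve_smooth E; have cE := smooth_continuous sE.
have fd x y t : is_derive t 1 (fun s => linform x y (E s)) (linform x y (E^`() t)).
  exact: is_derive_linform (smooth_differentiable t sE).
have [v vE] : exists v, v = E^`() by exists (E^`()).
rewrite -vE in dirB dirC trans sign fd; clear vE.
(* A common parameter would give a point on both diagonals, the origin, whose height is 0. *)
have sbsc : sb != sc.
  apply: contraTneq sbp => bc; have := Esc1.
  by rewrite -bc Esb1 => h; rewrite -leNgt; nra.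
have detAB : det2 (v sb) (v tb) = (v tb).1 * ((v sb).1 - (v sb).2).
  by rewrite /det2 (dirB tb Btb).2; ring.
have detCA : det2 (v tc) (v sc) = (v tc).1 * ((v sc).1 + (v sc).2).
  by rewrite /det2 (dirC tc Ctc).2; ring.
have detBC : det2 (v ub) (v uc) = - 2 * (v ub).1 * (v uc).1.
  by rewrite /det2 (dirB ub Bub).2 (dirC uc Cuc).2; ring.
have sig0 : sigma != 0 by case: hsig => ->; rewrite ?oppr_eq0 oner_eq0.
(* The forms [sigma * (y - x)] and [sigma * (x + y)] vanish on the lines of B and C. On A each has a
   single simple zero, at sb and sc respectively, and is positive at the other of these parameters,
   so [sgz_derive_side] applies. *)
have dg0 : linform (- sigma) sigma (v sb) != 0.
  have := trans _ _ _ xE; rewrite detAB mulf_eq0 negb_or => /andP[_].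
  apply: contra_neq => h; apply: (mulfI sig0).
  by rewrite mulr0; move: h; rewrite /linform; lra.
have dh0 : linform sigma sigma (v sc) != 0.
  have := trans _ _ _ zE; rewrite detCA mulf_eq0 negb_or => /andP[_].
  apply: contra_neq => h; apply: (mulfI sig0).
  by rewrite mulr0; move: h; rewrite /linform; lra.
have g0 s : linform (- sigma) sigma (E s) = 0 -> (E s).2 = (E s).1.
  rewrite /linform => h; apply: (mulfI sig0); lra.
have h0 s : linform sigma sigma (E s) = 0 -> (E s).2 = - (E s).1.
  rewrite /linform => h; apply: (mulfI sig0); lra.
have gE : sgz (linform (- sigma) sigma (v sb)) = sA.
  apply: (sgz_derive_side (continuous_linform cE) (fd _ _ sb) _ dg0 Asb Asc).
  - by rewrite /linform Esb1; ring.
  - by rewrite /linform Esc1; lra.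
  - by move=> s As /g0; exact: zeroB.
have hE : sgz (linform sigma sigma (v sc)) = - sA.
  rewrite /sA -sgzN opprB.
  apply: (sgz_derive_side (continuous_linform cE) (fd _ _ sc) _ dh0 Asc Asb).
  - by rewrite /linform Esc1; ring.
  - by rewrite /linform Esb1; lra.
  - by move=> s As /h0; exact: zeroC.
have hsA : is_sign sA.
  move: sbsc; rewrite /sA neq_lt => /orP[lt_bc|lt_cb].
    by left; rewrite gtr0_sgz // subr_gt0.
  by right; rewrite ltr0_sgz // subr_lt0.
have sigs : sgz sigma * sgz sigma = 1.
  by case: hsig => ->; rewrite ?sgzN sgz1 ?mulrNN mulr1.
exists beta, gamma; split; first by [].
- by split.
- split.
  + rewrite (sign _ _ _ xE) detAB sgzM (dirB _ Btb).1; congr (_ * _).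
    rewrite -mulrA -mulrN; congr (_ * _).
    rewrite -gE (_ : linform _ _ _ = - (sigma * ((v sb).1 - (v sb).2))).
      by rewrite sgzN sgzM mulrN mulrA sigs mul1r opprK.
    by rewrite /linform; ring.
  + rewrite (sign _ _ _ yE) detBC !sgzM (dirB _ Bub).1 (dirC _ Cuc).1 sgzN.
    by rewrite (gtr0_sgz (ltr0n R 2)) !mulN1r mulNr.
  + rewrite (sign _ _ _ zE) detCA sgzM (dirC _ Ctc).1; congr (_ * _).
    rewrite -mulrA -mulrN; congr (_ * _).
    rewrite -[sA]opprK -hE (_ : linform _ _ _ = sigma * ((v sc).1 + (v sc).2)).
      by rewrite sgzM mulrN opprK mulrA sigs mul1r.
    by rewrite /linform; ring.
- split.
  + rewrite posB // Eub0 subr0 -Esb Esb1 mulrC; congr (_ * _).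
    by rewrite -[LHS]mul1r -sigs -mulrA -sgzM (gtr0_sgz sbp) mulr1.
  + rewrite posC // -Eub Eub0 sub0r Esc Esc1 opprK mulrC; congr (_ * _).
    by rewrite -[LHS]mul1r -sigs -mulrA -sgzM (gtr0_sgz scp) mulr1.
(* On A the form [sigma * (x + y)] vanishes only at sc, so it stays positive from sb to the end of A
   that is not beyond sc. *)
- have hform s : linform sigma sigma (E s) = sigma * ((E s).1 + (E s).2).
    by rewrite /linform; ring.
  have hsb : 0 < linform sigma sigma (E sb) by rewrite /linform Esb1; lra.
  have /andP[asb sba] := Asb; have /andP[asc sca] := Asc.
  split=> sAE; rewrite -hform.
  + have lt_bc : sb < sc by rewrite -subr_gt0 -sgz_gt0 -/sA sAE.
    apply: (no_zero_pos_left (continuous_linform cE) asb hsb) => x /andP[ax xb].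
    apply/eqP => /h0 fx; suff xc : x = sc by move: xb; rewrite xc leNgt lt_bc.
    by apply: zeroC fx; rewrite /A /strand ax (le_trans xb).
  + have lt_cb : sc < sb by rewrite -subr_lt0 -sgz_lt0 -/sA sAE.
    apply: (no_zero_pos (continuous_linform cE) sba hsb) => x /andP[bx xa].
    apply/eqP => /h0 fx; suff xc : x = sc by move: bx; rewrite xc leNgt lt_cb.
    by apply: zeroC fx; rewrite /A /strand xa (le_trans _ bx).
Qed.

End ThirdMove.

(** * Invariance under the third Reidemeister move *)

Section ThirdMoveInvariance.
Variable R : realType.
Implicit Types (D : diagram R) (a b c d s t u : R) (e : R * R).

Lemma strands_sgz a b c d s s' t t' : a < b -> c < d ->
    disjoint_strands (strand a b) (strand c d) ->
    strand a b s -> strand a b s' -> strand c d t -> strand c d t' ->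
  sgz (s - t) = sgz (s' - t').
Proof.
move=> ab cd dis As As' Bt Bt'.
have nB x : strand a b x -> ~~ strand c d x by move=> Ax; have := dis x; rewrite Ax.
have nA x : strand c d x -> ~~ strand a b x.
  by move=> Bx; have := dis x; rewrite Bx andbT.
rewrite (strand_sgz As As' (nA t Bt)) sgz_antisym [RHS]sgz_antisym.
by rewrite (strand_sgz Bt Bt' (nB s' As')).
Qed.

Lemma strands_neq (A B : pred R) s t : disjoint_strands A B -> A s -> B t -> s != t.
Proof.
move=> dis As Bt; have := dis s; rewrite As => nBs.
by apply: contraTneq Bt => <-.
Qed.

(* 1 if the cyclic order of a, b, c is that of decreasing numbers, and -1 if it
   is the opposite one. *)
Definition cyclic_sign a b c : int := sgz (b - c) + sgz (c - a) + sgz (a - b).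

Lemma cyclic_sign_is_sign a b c : a != b -> b != c -> c != a ->
  is_sign (cyclic_sign a b c).
Proof.
rewrite /cyclic_sign => ab bc ca; rewrite !sgz_sub //.
case: (ltgtP b c) bc => // bc _; case: (ltgtP c a) ca => // ca _;
case: (ltgtP a b) ab => // ab _; rewrite /is_sign; try by [left|right].
- by exfalso; lra.
- by exfalso; lra.
Qed.

(** Identifies the directions of an unmoved strand in both diagrams: l compares the parameters of
    its two ends, k their positions. *)
Lemma is_sign_mul_inj (i j k l : int) :
  is_sign i -> is_sign j -> l = -1 -> l = i * k -> l = j * k -> i = j.
Proof. by case=> ->; case=> -> ->; lia. Qed.

Lemma perm_rot3 (T : eqType) (x y z : T) L :
  perm_eq [:: x, y, z & L] [:: y, z, x & L].
Proof. by apply/permP => f /=; lia. Qed.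

Lemma perm_swap3 (T : eqType) (x y z : T) L :
  perm_eq [:: x, y, z & L] [:: x, z, y & L].
Proof. by apply/permP => f /=; lia. Qed.

(** Of the four signs in [inter_mk], three compare different strands and add up to tau; the fourth
    compares the two crossings on the common strand. *)
Lemma inter_triangle (a1 a2 b1 b2 c1 c2 sb sc tb tc ub uc : R)
    (abv bcv cav : bool) (rest : seq (R * R)) :
  let A := strand a1 a2 in
  let B := strand b1 b2 in
  let C := strand c1 c2 in
  let x := mkcrossing abv sb tb in
  let y := mkcrossing bcv ub uc in
  let z := mkcrossing cav tc sc in
  let tau := cyclic_sign a1 b1 c1 in
  a1 < a2 -> b1 < b2 -> c1 < c2 ->
  disjoint_strands A B -> disjoint_strands A C -> disjoint_strands B C ->
  A sb -> A sc -> B tb -> C tc -> B ub -> C uc ->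
  distinct_params [:: x, y, z & rest] ->
  [/\ inter x y *+ 2 = bsgn abv * bsgn bcv * (tau - sgz (tb - ub)),
      inter y z *+ 2 = bsgn bcv * bsgn cav * (tau - sgz (uc - tc)) &
      inter z x *+ 2 = bsgn cav * bsgn abv * (tau - sgz (sc - sb))] /\
  [/\ inter y x = - inter x y, inter z y = - inter y z & inter x z = - inter z x].
Proof.
move=> A B C x y z tau a12 b12 c12 dAB dAC dBC Asb Asc Btb Ctc Bub Cuc sep.
have Aa : A a1 by rewrite /A /strand lexx ltW.
have Bb : B b1 by rewrite /B /strand lexx ltW.
have Cc : C c1 by rewrite /C /strand lexx ltW.
have uxy : uniq [:: sb; tb; ub; uc] by exact: distinct_params_mk sep.
have sep' : distinct_params [:: y, z, x & rest].
  by rewrite -(distinct_params_perm (perm_rot3 x y z rest)).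
have sep'' : distinct_params [:: z, x, y & rest].
  by rewrite -(distinct_params_perm (perm_rot3 y z x rest)).
have uyz : uniq [:: ub; uc; tc; sc] by exact: distinct_params_mk sep'.
have uzx : uniq [:: tc; sc; sb; tb] by exact: distinct_params_mk sep''.
have hAB s t : A s -> B t -> sgz (s - t) = sgz (a1 - b1).
  by move=> As Bt; apply: strands_sgz dAB As Aa Bt Bb.
have hBC s t : B s -> C t -> sgz (s - t) = sgz (b1 - c1).
  by move=> Bs Ct; apply: strands_sgz dBC Bs Bb Ct Cc.
have hCA s t : C s -> A t -> sgz (s - t) = sgz (c1 - a1).
  by move=> Cs At; rewrite sgz_antisym [RHS]sgz_antisym (strands_sgz _ _ dAC At Aa Cs Cc).
have alg1 (i j k l : int) : i - - j - l + k = i + j + k - l by ring.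
have alg2 (i j k l : int) : j - - k - l + i = i + j + k - l by ring.
have alg3 (i j k l : int) : k - - i - l + j = i + j + k - l by ring.
split; split; last 3 first.
- exact/inter_antisym/uniq_mk.
- exact/inter_antisym/uniq_mk.
- exact/inter_antisym/uniq_mk.
- rewrite (inter_mk _ _ uxy) (hBC tb uc) // (sgz_antisym sb uc) (hCA uc sb) //.
  by rewrite (hAB sb ub) //; congr (_ * _); exact: alg1.
- rewrite (inter_mk _ _ uyz) (hCA uc sc) // (hBC ub tc) //.
  by rewrite (sgz_antisym ub sc) (hAB sc ub) //; congr (_ * _); exact: alg2.
- rewrite (inter_mk _ _ uzx) (hAB sc tb) // (sgz_antisym tc tb) (hBC tb tc) //.
  by rewrite (hCA tc sb) //; congr (_ * _); exact: alg3.
Qed.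

(** Depends only on the side of e on which s lies, and is larger by 2 on the left; its increment
    along a chord is twice the intersection number with e. *)
Definition offset e s : int := sgz (s - e.2) - sgz (s - e.1).

Lemma inter_far o s t e : s != t -> e.1 != e.2 ->
    s != e.1 -> s != e.2 -> t != e.1 -> t != e.2 ->
  inter (mkcrossing o s t) e *+ 2 = bsgn o * (offset e t - offset e s) /\
  inter e (mkcrossing o s t) = - inter (mkcrossing o s t) e.
Proof.
move=> st e12 s1 s2 t1 t2.
have u : uniq [:: s; t; e.1; e.2] by rewrite /= !inE !negb_or st e12 s1 s2 t1 t2.
have eE : e = mkcrossing true e.1 e.2 by case: (e).
split; last exact: inter_antisym (uniq_mk o true u).
have alg (i j k l : int) : i - j - k + l = i - k - (j - l).
  by ring.
by rewrite {1}eE (inter_mk _ _ u) mulr1; congr (_ * _); exact: alg.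
Qed.

Lemma inter_far_strands a b c d o s t e : a < b -> c < d ->
    disjoint_strands (strand a b) (strand c d) ->
    strand a b s -> strand c d t -> e.1 != e.2 ->
    ~~ strand a b e.1 /\ ~~ strand a b e.2 -> ~~ strand c d e.1 /\ ~~ strand c d e.2 ->
  inter (mkcrossing o s t) e *+ 2 = bsgn o * (offset e c - offset e a) /\
  inter e (mkcrossing o s t) = - inter (mkcrossing o s t) e.
Proof.
move=> ab cd dis As Bt e12 [A1 A2] [B1 B2].
have aA : strand a b a by rewrite /strand lexx ltW.
have cB : strand c d c by rewrite /strand lexx ltW.
have out (P : pred R) (u w : R) : P u -> ~~ P w -> u != w.
  by move=> Pu; apply: contraNneq => <-.
have st := strands_neq dis As Bt.
have [|||| -> ->] := @inter_far o s t e st e12;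
  [exact: out As A1|exact: out As A2|exact: out Bt B1|exact: out Bt B2|].
rewrite /offset (strand_sgz As aA A1) (strand_sgz As aA A2).
by rewrite (strand_sgz Bt cB B1) (strand_sgz Bt cB B2).
Qed.

(** Multiplying by the signs removes the over/under factors, and the three differences telescope
    around the triangle. *)
Lemma triangle_relation o1 o2 o3 (i1 i2 i3 j1 j2 j3 : int) :
    i1 *+ 2 = bsgn o1 * (j2 - j1) -> i2 *+ 2 = bsgn o2 * (j3 - j2) ->
    i3 *+ 2 = bsgn o3 * (j1 - j3) ->
  bsgn o1 * i1 + bsgn o2 * i2 + bsgn o3 * i3 = 0.
Proof. by case: o1; case: o2; case: o3 => /=; lia. Qed.

(** [triangle_signs] is applied with sigma = 1 before the move and sigma = -1 after it. The
    directions of B and C persist, the order on A is reversed, and [wcoef_triangle] concludes. *)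
Lemma reidemeister3_Hcoef D D' n : reidemeister3 D D' -> Hcoef D n = Hcoef D' n.
Proof.
case=> a1 [a2 [b1 [b2 [c1 [c2 [sb [sc [sb' [sc' [tb [tc [tb' [tc' [ub [uc]]]]]]]]]]]]]]].
case=> abv [bcv [cav [rest]]].
move=> [[[pA pB pC] [dAB dAC dBC]] mv [lineB lineC]].
move=> [[Asb Asc Asb' Asc'] [Btb Btb' Ctc Ctc'] [Bub Cuc] [ysb ysc] [ysb' ysc']].
move=> [_ free perm perm'].
have [/and3P[a10 a12 a21] /and3P[b10 b12 b21] /and3P[c10 c12 c21]] := And3 pA pB pC.
have [sqD sqD' agree] := mv.
set A := strand a1 a2 in Asb Asc Asb' Asc' dAB dAC mv sqD sqD' agree free.
set B := strand b1 b2 in Btb Btb' Bub lineB dAB dBC mv sqD sqD' free.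
set C := strand c1 c2 in Ctc Ctc' Cuc lineC dAC dBC mv sqD sqD' free.
have DB t : B t -> D t = D' t.
  move=> Bt; apply: agree; last by apply/negP => At; have := dAB t; rewrite At Bt.
  by apply: mem_unit_itv; move: Bt; rewrite /B /strand; lra.
have DC t : C t -> D t = D' t.
  move=> Ct; apply: agree; last by apply/negP => At; have := dAC t; rewrite At Ct.
  by apply: mem_unit_itv; move: Ct; rewrite /C /strand; lra.
have cD := smooth_continuous (curve_smooth D).
have cD' := smooth_continuous (curve_smooth D').
have Da1 : D a1 = D' a1.
  apply: (@eq_left_limit _ _ _ _ 0) => // s /andP[s0 sc0]; apply: agree.
    by apply: mem_unit_itv; lra.
  by rewrite /A /strand negb_and -!ltNge sc0.
have Da2 : D a2 = D' a2.
  apply: (@eq_right_limit _ _ _ _ 1) => // s /andP[s0 sc0]; apply: agree.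
    by apply: mem_unit_itv; lra.
  by rewrite /A /strand negb_and -!ltNge s0 orbT.
have [beta [gamma [[hb hg hsA] [posB posC] [exD eyD ezD] [sB sC] [end1 end2]]]] :=
  triangle_signs pA pB pC dAB dAC dBC sqD lineB lineC Asb Asc Btb Ctc Bub Cuc
    (or_introl erefl) (eq_ind _ (fun x => is_true (0 < x)) ysb _ (esym (mul1r _)))
    (eq_ind _ (fun x => is_true (0 < x)) ysc _ (esym (mul1r _))) free perm.
have lineB' t : B t -> (D' t).2 = (D' t).1 by move=> Bt; rewrite -DB // lineB.
have lineC' t : C t -> (D' t).2 = - (D' t).1 by move=> Ct; rewrite -DC // lineC.
have nsb' : 0 < -1 * (D' sb').2 by rewrite mulN1r oppr_gt0.
have nsc' : 0 < -1 * (D' sc').2 by rewrite mulN1r oppr_gt0.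
have [beta' [gamma' [[hb' hg' hsA'] [posB' posC'] [exD' eyD' ezD'] [sB' sC']
    [end1' end2']]]] :=
  triangle_signs pA pB pC dAB dAC dBC sqD' lineB' lineC' Asb' Asc' Btb' Ctc' Bub Cuc
    (or_intror erefl) nsb' nsc' free perm'.
have aA : A a1 by rewrite /A /strand lexx ltW.
have bB : B b1 by rewrite /B /strand lexx ltW.
have bB2 : B b2 by rewrite /B /strand lexx ltW.
have cC : C c1 by rewrite /C /strand lexx ltW.
have cC2 : C c2 by rewrite /C /strand lexx ltW.
have bb : beta' = beta.
  apply: is_sign_mul_inj hb' hb _ (posB' _ _ bB bB2) _.
    by rewrite ltr0_sgz // subr_lt0.
  by rewrite posB // !DB.
have gg : gamma' = gamma.
  apply: is_sign_mul_inj hg' hg _ (posC' _ _ cC cC2) _.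
    by rewrite ltr0_sgz // subr_lt0.
  by rewrite posC // !DC.
(* With the same order on A before and after, one end of A would lie strictly on both sides of the
   line of C, although this end is fixed. *)
have sAA : sgz (sc' - sb') = - sgz (sc - sb).
  case: hsA hsA' => -E1 [] E2; rewrite E1 E2 ?opprK //.
  - have := end1' E2; rewrite mulN1r oppr_gt0 -Da1 ltNge => /negP[].
    by have := end1 E1; rewrite mul1r => /ltW.
  - have := end2' E2; rewrite mulN1r oppr_gt0 -Da2 ltNge => /negP[].
    by have := end2 E1; rewrite mul1r => /ltW.
clear end1 end2 end1' end2' posB posC posB' posC' ysb ysc ysb' ysc' nsb' nsc'.
rewrite ?sgzN ?sgz1 ?mulr1 ?mul1r ?mulN1r ?mulrN1 in exD ezD exD' ezD' sB sC sB' sC'.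
set x := mkcrossing abv sb tb in perm exD.
set y := mkcrossing bcv ub uc in perm eyD perm' eyD'.
set z := mkcrossing cav tc sc in perm ezD.
set x' := mkcrossing abv sb' tb' in perm' exD'.
set z' := mkcrossing cav tc' sc' in perm' ezD'.
have permL := perm_trans perm (perm_swap3 x z y rest).
have permL' := perm_trans perm' (perm_swap3 x' z' y rest).
have sepL : distinct_params [:: x, y, z & rest].
  by rewrite -(distinct_params_perm permL); exact: crossings_uniq.
have sepL' : distinct_params [:: x', y, z' & rest].
  by rewrite -(distinct_params_perm permL'); exact: crossings_uniq.
have restD e : e \in rest -> e \in crossings D.
  by move=> er; rewrite (perm_mem permL) !inE er !orbT.
have [[xy yz zx] [yx zy xz]] := inter_triangle a12 b12 c12 dAB dAC dBC
  Asb Asc Btb Ctc Bub Cuc sepL.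
have [[xy' yz' zx'] [yx' zy' xz']] := inter_triangle a12 b12 c12 dAB dAC dBC
  Asb' Asc' Btb' Ctc' Bub Cuc sepL'.
rewrite sB sC in xy yz; rewrite sB' sC' sAA bb gg ?opprK in xy' yz' zx'.
have farI e : e \in rest -> [/\ ~~ A e.1 /\ ~~ A e.2, ~~ B e.1 /\ ~~ B e.2
    & ~~ C e.1 /\ ~~ C e.2].
  move=> er; have /andP[] := allP free e er; rewrite /= !negb_or.
  by move=> /and3P[-> -> ->] /and3P[-> -> ->].
have e12 e : e \in rest -> e.1 != e.2.
  by move=> er; apply: (distinct_params_neq sepL); rewrite !inE er !orbT.
have dCA := disjoint_strands_sym dAC.
have fx e : e \in rest -> inter x e *+ 2 = bsgn abv * (offset e b1 - offset e a1) /\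
    inter e x = - inter x e.
  move=> er; have [h1 h2 h3] := farI e er.
  exact: (inter_far_strands _ a12 b12 dAB Asb Btb (e12 e er) h1 h2).
have fx' e : e \in rest -> inter x' e *+ 2 = bsgn abv * (offset e b1 - offset e a1) /\
    inter e x' = - inter x' e.
  move=> er; have [h1 h2 h3] := farI e er.
  exact: (inter_far_strands _ a12 b12 dAB Asb' Btb' (e12 e er) h1 h2).
have fy e : e \in rest -> inter y e *+ 2 = bsgn bcv * (offset e c1 - offset e b1) /\
    inter e y = - inter y e.
  move=> er; have [h1 h2 h3] := farI e er.
  exact: (inter_far_strands _ b12 c12 dBC Bub Cuc (e12 e er) h2 h3).
have fz e : e \in rest -> inter z e *+ 2 = bsgn cav * (offset e a1 - offset e c1) /\
    inter e z = - inter z e.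
  move=> er; have [h1 h2 h3] := farI e er.
  exact: (inter_far_strands _ c12 a12 dCA Ctc Asc (e12 e er) h3 h1).
have fz' e : e \in rest -> inter z' e *+ 2 = bsgn cav * (offset e a1 - offset e c1) /\
    inter e z' = - inter z' e.
  move=> er; have [h1 h2 h3] := farI e er.
  exact: (inter_far_strands _ c12 a12 dCA Ctc' Asc' (e12 e er) h3 h1).
have signs e : e \in rest -> crossing_sign D e = crossing_sign D' e.
  move=> er; have [[h1 h2] _ _] := farI e er.
  exact: crossing_sign_outside mv (crossings_inner (restD e er)) h1 h2.
have htau : is_sign (cyclic_sign a1 b1 c1).
  apply: cyclic_sign_is_sign; first exact: strands_neq dAB aA bB.
    exact: strands_neq dBC bB cC.
  exact: strands_neq dCA cC aA.
set tau := cyclic_sign a1 b1 c1 in htau xy yz zx xy' yz' zx'.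
set sA := sgz (sc - sb) in hsA sAA exD ezD zx zx'.
(* The value of delta read off from the three crossing signs, when beta and gamma serve as sB and
   sC. *)
have hdelta : is_sign (- (beta * gamma * sA)).
  by case: hb => ->; case: hg => ->; case: hsA => ->; try (by left); right.
have wrest : wcoef (@inter R) (crossing_sign D) [:: x, y, z & rest] n =
             wcoef (@inter R) (crossing_sign D') [:: x', y, z' & rest] n.
  (* Both lists are indexed by positions, the triangle being 0, 1, 2, so that two systems on the
     same set are compared although x and z have moved. *)
  pose p := nth (0, 0) [:: x, y, z & rest].
  pose p' := nth (0, 0) [:: x', y, z' & rest].
  pose idx := [:: 0, 1, 2 & iota 3 (size rest)]%N.
  have -> : [:: x, y, z & rest] = map p idx by rewrite -[LHS](mkseq_nth (0, 0)).
  have -> : [:: x', y, z' & rest] = map p' idx by rewrite -[LHS](mkseq_nth (0, 0)).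
  have restP i : i \in iota 3 (size rest) -> p i \in rest /\ p' i = p i.
    by case: i => [|[|[|j]]]; rewrite mem_iota //= => jr; split=> //; exact: mem_nth.
  apply: (etrans (wcoef_map p _ _ _ _)); apply/esym.
  apply: (etrans (wcoef_map p' _ _ _ _)); apply/esym.
  apply: (etrans (@wcoef_triangle _ _ (fun i j => inter (p' i) (p' j)) _ 0%N 1%N 2%N
    (iota 3 (size rest)) n sA beta gamma tau _ _ _ _ hsA hb hg htau hdelta
    (bsgn_is_sign abv) (bsgn_is_sign bcv) (bsgn_is_sign cav) _ _ _ _ _ _ _ _ _ _)).
  - by split; exact: inter_self.
  - by split; exact: inter_self.
  - by split; [exact: yx|exact: zy|exact: xz].
  - by split; [exact: yx'|exact: zy'|exact: xz'].
  - by split; [exact: xy|exact: yz|exact: zx].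
  - by split; [exact: xy'|exact: yz'|exact: zx'].
  - split.
    + apply: (etrans exD); case: hg => ->; by ring.
    + apply: (etrans eyD); case: hsA => ->; by ring.
    + apply: (etrans ezD); case: hb => ->; by ring.
  - move=> i /restP[pi _].
    exact: triangle_relation (fx _ pi).1 (fy _ pi).1 (fz _ pi).1.
  - move=> i /restP[pi ->]; split; last 1 first.
    + by apply: mulr2n_int_inj; rewrite (fz _ pi).1 (fz' _ pi).1.
    + by apply: mulr2n_int_inj; rewrite (fx _ pi).1 (fx' _ pi).1.
    + by [].
  - move=> i /restP[pi pE] j; rewrite /= pE !inE.
    move=> /or4P[/eqP ->|/eqP ->|/eqP ->|/restP[_ ->]].
    + rewrite -[p' 0%N]/x' -[p 0%N]/x (fx _ pi).2 (fx' _ pi).2.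
      by congr (- _); apply: mulr2n_int_inj; rewrite (fx _ pi).1 (fx' _ pi).1.
    + by [].
    + rewrite -[p' 2%N]/z' -[p 2%N]/z (fz _ pi).2 (fz' _ pi).2.
      by congr (- _); apply: mulr2n_int_inj; rewrite (fz _ pi).1 (fz' _ pi).1.
    + by [].
  apply: wcoef_ext => [i j _ _|i]; first by [].
  rewrite /= !inE => /or4P[/eqP ->|/eqP ->|/eqP ->|/restP[pi ->]].
  - apply: (etrans exD); apply: (etrans _ (esym exD')).
    by rewrite sAA bb; congr (_ * _); ring.
  - by apply: (etrans eyD); apply: (etrans _ (esym eyD')); rewrite bb gg.
  - apply: (etrans ezD); apply: (etrans _ (esym ezD')).
    by rewrite sAA gg; congr (_ * _); ring.
  - exact: signs.
exact: etrans (wcoef_perm _ _ _ permL) (etrans wrest (esym (wcoef_perm _ _ _ permL'))).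
Qed.

End ThirdMoveInvariance.

(** * Planar isotopies *)

Section Isotopy.
Variable R : realType.
Implicit Types (D : diagram R) (p q v w : R * R) (s t : R).

Lemma det2_linear (L : {linear (R * R)%type -> (R * R)%type}) v w :
  det2 (L v) (L w) = det2 (L (1, 0)) (L (0, 1)) * det2 v w.
Proof.
have LE u : L u = u.1 *: L (1, 0) + u.2 *: L (0, 1).
  rewrite -!linearZ -linearD; congr (L _); case: u => a b.
  have h1 : a = a * 1 + b * 0 by ring.
  have h2 : b = a * 0 + b * 1 by ring.
  exact: (f_equal2 pair h1 h2).
rewrite (LE v) (LE w); move: (L (1, 0)) (L (0, 1)) => [a b] [c d].
have : (v.1 * a + v.2 * c) * (w.1 * b + w.2 * d) -
       (v.1 * b + v.2 * d) * (w.1 * a + w.2 * c) =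
       (a * d - b * c) * (v.1 * w.2 - v.2 * w.1) by ring.
exact.
Qed.

Lemma linear_scale (V : lmodType R) (L : {linear R -> V}) (a : R) :
  L a = a *: L 1.
Proof. by rewrite -linearZ; congr (L _); rewrite -[LHS]mulr1. Qed.

Lemma det2_gt0_linear (L : {linear (R * R)%type -> (R * R)%type}) (a b : R) v w :
    0 < a -> 0 < b -> 0 < det2 (L (1, 0)) (L (0, 1)) ->
  (0 < det2 (a *: L v) (b *: L w)) = (0 < det2 v w).
Proof.
move=> a0 b0 L0; have -> : det2 (a *: L v) (b *: L w) = a * b * det2 (L v) (L w).
  have : a * (L v).1 * (b * (L w).2) - a * (L v).2 * (b * (L w).1) =
         a * b * ((L v).1 * (L w).2 - (L v).2 * (L w).1) by ring.
  exact.
by rewrite det2_linear !pmulr_rgt0 // mulr_gt0.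
Qed.

Lemma derive1_comp_curve (V : normedModType R) (f : V -> R * R) (c : R -> V) s :
  differentiable c s -> differentiable f (c s) ->
  (f \o c)^`() s = 'd f (c s) (c^`() s).
Proof.
move=> dc df; rewrite !derive1E' //; last exact: differentiable_comp.
by rewrite (diff_comp dc df).
Qed.

Lemma continuous_det2 (T : topologicalType) (f g : T -> R * R) :
  continuous f -> continuous g -> continuous (fun x : T => det2 (f x) (g x)).
Proof.
move=> cf cg x.
have c1 (h : T -> R * R) : continuous h -> (h y).1 @[y --> x] --> (h x).1.
  by move=> ch; exact: (@continuous_comp T _ _ h fst x (ch x) (@cvg_fst _ _ _ _ _)).
have c2 (h : T -> R * R) : continuous h -> (h y).2 @[y --> x] --> (h x).2.
  by move=> ch; exact: (@continuous_comp T _ _ h snd x (ch x) (@cvg_snd _ _ _ _ _)).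
exact: cvgB (cvgM (c1 f cf) (c2 g cg)) (cvgM (c2 f cf) (c1 g cg)).
Qed.

Lemma det2_isotopy (F : R * (R * R) -> R * R) p : plane_isotopy F ->
  0 < det2 ('d (fun q => F (1, q)) p (1, 0)) ('d (fun q => F (1, q)) p (0, 1)).
Proof.
move=> [sF F0 inv].
have dinj t q : is_diff q (fun q => (t, q)) (fun v => (0, v) : R * (R * R)).
  exact: is_diff_pair.
have dF t q : differentiable (fun q => F (t, q)) q.
  apply: (@differentiable_comp _ _ _ _ (fun q => (t, q)) F).
    by apply: ex_diff.
  exact: smooth_differentiable.
have dFE t q v : 'd (fun q => F (t, q)) q v = 'D_(0, v) F (t, q).
  rewrite deriveE; last exact: smooth_differentiable.
  have -> : (fun q => F (t, q)) = F \o (fun q => (t, q)) by [].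
  rewrite diff_comp; [|by apply: ex_diff|exact: smooth_differentiable].
  by rewrite /= diff_val.
have det_e : det2 (1, 0) (0, 1) = 1 :> R by rewrite /det2 /= mulr1 mul0r subr0.
pose J t := det2 ('D_(0, (1, 0)) F (t, p)) ('D_(0, (0, 1)) F (t, p)).
have cJ : continuous J.
  have cD v : continuous (fun t => 'D_(0, v) F (t, p)).
    move=> t; apply: (@continuous_comp _ _ _ (fun t => (t, p)) ('D_(0, v) F)).
      by apply: differentiable_continuous; apply: differentiable_pair.
    exact: smooth_continuous (@smooth_derive _ _ _ F (0, v) sF) _.
  move=> t; apply: (@continuous_det2 _ (fun t => 'D_(0, (1, 0)) F (t, p))
    (fun t => 'D_(0, (0, 1)) F (t, p))); exact: cD.
have J0 : J 0 = 1.
  rewrite /J -!dFE (_ : (fun q => F (0, q)) = id); last exact/funext.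
  by rewrite !diff_val.
have J1 : 0 < J 1.
  apply: (no_zero_pos cJ (ler01 : 0 <= 1 :> R)); first by rewrite J0.
  move=> t /mem_unit_itv /inv [G sG [FK _]].
  have dG : differentiable G (F (t, p)) by exact: smooth_differentiable.
  have inverse v : 'd G (F (t, p)) ('D_(0, v) F (t, p)) = v.
    have GF : G \o (fun q => F (t, q)) = id by apply/funext => q; exact: FK.
    have idv : 'd (G \o (fun q => F (t, q))) p v = v by rewrite GF diff_val.
    rewrite -dFE; apply: (etrans _ idv).
    exact: esym (congr1 (fun f => f v) (diff_comp (dF t p) dG)).
  (* The differential of the inverse sends the columns of the Jacobian matrix to the standard basis;
     their determinant is thus a factor of 1, hence nonzero. *)
  have nondeg (L : {linear (R * R)%type -> (R * R)%type}) u w :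
      L u = (1, 0) -> L w = (0, 1) -> det2 u w != 0.
    move=> Lu Lw; have := det2_linear L u w; rewrite Lu Lw det_e.
    by move=> /esym/eqP; apply: contraTneq => ->; rewrite mulr0 eq_sym oner_eq0.
  exact: nondeg (inverse (1, 0)) (inverse (0, 1)).
by rewrite !dFE.
Qed.

(** Since both strands pass through the same point, their velocities are transformed by the same
    differential, up to the positive factors coming from r. *)
Lemma isotopic_crossing_sign D D' (F : R * (R * R) -> R * R) (r : R -> R) s t :
    plane_isotopy F -> smooth r ->
    (forall s, s \in `[0, 1] -> 0 < r^`() s) ->
    (forall s, s \in `[0, 1] -> D' s = F (1, D (r s))) ->
    0 < s < 1 -> 0 < t < 1 -> D (r s) = D (r t) ->
  crossing_sign D' (s, t) = crossing_sign D (r s, r t).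
Proof.
move=> iF sr rpos D'E s01 t01 Dst.
have [sF _ _] := iF; pose P q := F (1, q).
have sD := curve_smooth D.
have dP q : differentiable P q.
  apply: (@differentiable_comp _ _ _ _ (fun q => (1 : R, q)) F).
    by apply: differentiable_pair.
  exact: smooth_differentiable.
have derE u : 0 < u < 1 -> D'^`() u = derive1 r u *: 'd P (D (r u)) (D^`() (r u)).
  move=> u01; have dr : differentiable r u by exact: smooth_differentiable.
  have dD : differentiable D (r u) by exact: smooth_differentiable.
  have -> : D'^`() u = (P \o (D \o r))^`() u.
    apply: (@eq_derive1_near _ _ _ _ (Num.min u (1 - u))).
      by rewrite lt_min; lra.
    move=> x; rewrite -ltr_distlC lt_min !ltr_distlC => /andP[h1 h2].
    by rewrite D'E //; apply: mem_unit_itv; lra.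
  rewrite derive1_comp_curve; [|exact: differentiable_comp|exact: dP].
  have -> : (D \o r)^`() u = derive1 r u *: derive1 D (r u).
    rewrite !derive1E' //; last exact: differentiable_comp.
    apply: (etrans (congr1 (fun f => f 1) (diff_comp dr dD))).
    exact (linear_scale ('d D (r u)) ('d r u 1)).
  by rewrite linearZ.
rewrite !crossing_sign_det /= (derE s s01) (derE t t01) -Dst.
have rs : 0 < r^`() s by apply: rpos; apply: mem_unit_itv; lra.
have rt : 0 < r^`() t by apply: rpos; apply: mem_unit_itv; lra.
by rewrite (det2_gt0_linear _ _ rs rt (det2_isotopy (D (r s)) iF)).
Qed.

(** The map r is increasing and onto, so it matches the crossings of D' with those of D and
    preserves the order of the endpoints, hence all intersection numbers. *)
Lemma isotopic_Hcoef D D' n : isotopic D D' -> Hcoef D n = Hcoef D' n.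
Proof.
move=> [F [r [iF [sr r0 r1 rpos] D'E cross]]].
have cr := smooth_continuous sr.
have rmono : {in `[0, 1]%R &, {mono r : s t / s <= t}}.
  apply: le_mono_in => s t s01 t01 st.
  apply: (@gtr0_derive1_lt_cc R r 0 1) => //.
  - move=> x _; apply: diff_derivable; exact: smooth_differentiable.
  - move=> x; rewrite in_itv /= => /andP[x0 x1].
    by apply: rpos; apply: mem_unit_itv; rewrite !ltW.
  - exact: continuous_subspaceT.
have rlt := leW_mono_in rmono.
have rinj : {in `[0, 1]%R &, injective r} := inc_inj_in rmono.
have inr c : c \in crossings D' -> (c.1 \in `[0, 1]%R) && (c.2 \in `[0, 1]%R).
  move=> /crossings_inner /andP[/andP[h1 h2] /andP[h3 h4]].
  by rewrite !in_itv /= !ltW.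
have onto s : 0 < s < 1 -> exists2 t, t \in `[0, 1]%R & r t = s.
  move=> /andP[s0 s1]; have [||t t01 <-] := @IVT R r 0 1 s ler01.
  - exact: continuous_subspaceT.
  - by rewrite r0 r1 ge_min le_max (ltW s0) (ltW s1) orbT.
  - by exists t.
pose rr (c : R * R) := (r c.1, r c.2).
have uniqC (E : diagram R) : uniq (crossings E).
  have := @crossings_uniq _ E; rewrite cat_uniq => /andP[h _].
  exact: map_uniq h.
have perm : perm_eq (crossings D) (map rr (crossings D')).
  apply: uniq_perm; first exact: uniqC.
    rewrite map_inj_in_uniq ?uniqC // => c e /inr/andP[c1 c2] /inr/andP[e1 e2].
    case: c c1 c2 => c c' /= c1 c2; case: e e1 e2 => e e' /= e1 e2.
    by move=> [/rinj -> // /rinj ->].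
  move=> c; apply/idP/mapP => [cD|[e eD' ->]].
    have /andP[/onto[s s01 sE] /onto[t t01 tE]] := crossings_inner cD.
    exists (s, t); last by rewrite /rr /= sE tE; case: (c).
    by rewrite cross ?sE ?tE -?surjective_pairing // mem_unit_itv -?in_itv.
  have /andP[e1 e2] := inr e eD'.
  by rewrite /rr -cross -?surjective_pairing // mem_unit_itv -?in_itv.
apply: (etrans (wcoef_perm _ _ _ perm)); apply: (etrans (wcoef_map rr _ _ _ _)).
apply: wcoef_ext => [c e cD eD|c cD].
  have /andP[c1 c2] := inr c cD; have /andP[e1 e2] := inr e eD.
  by rewrite /inter /left_of /right_of /= !rlt.
have /andP[c1 c2] := inr c cD.
have /andP[/andP[h1 h2] /andP[h3 h4]] := crossings_inner cD.
have cD' : rr c \in crossings D.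
  rewrite /rr -cross -?surjective_pairing // mem_unit_itv // !ltW //.
rewrite /= [in RHS](surjective_pairing c); apply/esym.
apply: (isotopic_crossing_sign iF sr rpos D'E); rewrite ?h1 ?h3 //.
have m1 : r c.1 \in `[0, 1].
  have /andP[/andP[i1 i2] _] := crossings_inner cD'.
  by apply: mem_unit_itv; rewrite !ltW.
have m2 : r c.2 \in `[0, 1].
  have /andP[_ /andP[i1 i2]] := crossings_inner cD'.
  by apply: mem_unit_itv; rewrite !ltW.
have ne : r c.1 != r c.2.
  apply: contraNneq (distinct_params_neq (@crossings_uniq _ D') cD) => rE.
  by rewrite (rinj _ _ c1 c2 rE).
by apply/(@crossings_double _ D _ _ m1 m2 ne); left.
Qed.

End Isotopy.

(** * Crossing changes and the Gordian distance *)

Section CrossingChange.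
Variable R : realType.
Implicit Types (D : diagram R) (c e : R * R).

Lemma crossing_sign_agree D D' e :
    (forall s, s \in `[0, 1] -> D s = D' s) -> (0 < e.1 < 1) && (0 < e.2 < 1) ->
  crossing_sign D e = crossing_sign D' e.
Proof.
move=> DD' /andP[e1 e2].
have der s : 0 < s < 1 -> D^`() s = D'^`() s.
  move=> s01; apply: (@eq_derive1_near _ _ _ _ (Num.min s (1 - s))).
    by rewrite lt_min; lra.
  move=> x; rewrite -ltr_distlC lt_min !ltr_distlC => /andP[h1 h2].
  by apply: DD'; apply: mem_unit_itv; lra.
by rewrite !crossing_sign_det !der.
Qed.

Lemma crossing_sign_swap D c : c \in crossings D ->
  crossing_sign D (c.2, c.1) = - crossing_sign D c.
Proof.
move=> /crossings_transverse; rewrite !crossing_sign_det /=.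
move: (D^`() c.1) (D^`() c.2) => v w vw.
rewrite (det2_opp v w) oppr_gt0.
by case: ltgtP vw => //= _ _; rewrite opprK.
Qed.

Lemma inter_swap c e : uniq [:: c.1; c.2; e.1; e.2] ->
  inter (c.2, c.1) e = - inter c e.
Proof.
move=> u; apply: mulr2n_int_inj; rewrite mulNrn (interE u) interE /=.
  by ring.
exact: (uniq_mk false true u).
Qed.

(** The degree of the changed chord gives N, the same for all n, and its n-th index gives [p n]; the
    bound M will make the expansion finite. *)
Lemma crossing_change_Hcoef D D' : crossing_change D D' ->
  exists (eps : int) (N : nat) (p : nat -> laurent) (M : nat),
  [/\ is_sign eps,
      forall n, Hcoef D n - Hcoef D' n = eps *: bterm N (p n) n
    & forall n, (M <= n)%N -> p n = 0].
Proof.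
move=> [c [rest [DD' perm perm']]].
have [M bound] := Hdiag_Hcoef D.
have cD : c \in crossings D by rewrite (perm_mem perm) inE eqxx.
have sep : distinct_params (c :: rest).
  by rewrite -(distinct_params_perm perm); exact: crossings_uniq.
have restD e : e \in rest -> e \in crossings D.
  by move=> er; rewrite (perm_mem perm) inE er orbT.
have cr : c \notin rest.
  move: sep; rewrite /distinct_params /= mem_cat negb_or -andbA => /and3P[h _ _].
  by apply: contra h => h; exact: map_f.
(* Relabels the crossings of D' by those of D, so that [wcoef_flip] compares two systems on one
   list. *)
pose f e := if e == c then (c.2, c.1) else e.
have fc : f c = (c.2, c.1) by rewrite /f eqxx.
have fr e : e \in rest -> f e = e.
  by move=> er; rewrite /f; case: eqP => // ec; move: cr; rewrite -ec er.
have lE : (c.2, c.1) :: rest = map f (c :: rest).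
  rewrite /= fc; congr cons; rewrite -[LHS]map_id; apply/eq_in_map => e er.
  by rewrite fr.
clearbody f.
have uce e : e \in rest -> uniq [:: c.1; c.2; e.1; e.2].
  move=> er; apply: (distinct_paramsP sep); rewrite ?inE ?eqxx ?er ?orbT //.
  by apply: contraNneq cr => ->.
have uc'e e : e \in rest -> uniq [:: c.2; c.1; e.1; e.2].
  by move=> er; exact: (uniq_mk false true (uce e er)).
exists (crossing_sign D c), `|wdeg (@inter R) (crossing_sign D) (c :: rest) c|%N,
  (fun n => windex (@inter R) (crossing_sign D) (c :: rest) n c), M; split.
- exact: crossing_sign_is_sign.
- move=> n; have -> : Hcoef D n = wcoef (@inter R) (crossing_sign D) (c :: rest) n.
    exact: wcoef_perm.
  have -> : Hcoef D' n = wcoef (fun e e' => inter (f e) (f e'))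
      (crossing_sign D' \o f) (c :: rest) n.
    by apply: (etrans (wcoef_perm _ _ _ perm')); rewrite lE; exact: wcoef_map.
  apply: wcoef_flip.
  + exact: inter_self.
  + exact: inter_self.
  + by move=> e e' er er'; rewrite /= !fr.
  + move=> e er; rewrite /= (fr e er).
    exact: crossing_sign_agree DD' (crossings_inner (restD e er)).
  + move=> e er; rewrite fc (fr e er) (inter_swap (uce e er)).
    split; first by [].
    rewrite (@inter_antisym _ (c.2, c.1) e (uc'e e er)) (inter_swap (uce e er)).
    by rewrite (inter_antisym (uce e er)).
  + rewrite /= fc; apply: (etrans _ (crossing_sign_swap cD)); symmetry.
    apply: crossing_sign_agree DD' _; rewrite /= andbC.
    exact: crossings_inner cD.
- move=> n Mn; have [h _] := bound n Mn.
  by rewrite -(windex_perm _ _ _ perm) h.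
Qed.

Lemma move_Hcoef D D' n : move D D' -> Hcoef D n = Hcoef D' n.
Proof.
case=> h; first exact: isotopic_Hcoef.
- exact: esym (reidemeister1_Hcoef n h).
- exact: esym (reidemeister2_Hcoef n h).
- exact: reidemeister3_Hcoef.
Qed.

(** The differences telescope along the sequence: moves contribute nothing, and the i-th crossing
    change contributes the i-th term simultaneously for all n. *)
Lemma transformable_Hcoef k D D' : transformable k D D' ->
  exists (eps : nat -> int) (N : nat -> nat) (p : nat -> nat -> laurent) (M : nat),
  [/\ forall i, is_sign (eps i),
      forall n, Hcoef D n - Hcoef D' n = \sum_(i < k) eps i *: bterm (N i) (p i n) n
    & forall i n, (i < k)%N -> (M <= n)%N -> p i n = 0].
Proof.
elim=> {k D D'} [D|k D D1 D2 _ [eps [N [p [M [h1 h2 h3]]]]] mv|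
    k D D1 D2 _ [eps [N [p [M [h1 h2 h3]]]]] /crossing_change_Hcoef
    [eps' [N' [p' [M' [h1' h2' h3']]]]]].
(* The sum is empty, so any witnesses do, provided that eps takes values 1 or -1. *)
- exists (fun=> 1), (fun=> 0%N), (fun _ _ => 0), 0%N; split=> //; first by left.
  by move=> n; rewrite big_ord0 subrr.
- exists eps, N, p, M; split; [exact: h1|move=> n|exact: h3].
  have E : Hcoef D2 n = Hcoef D1 n.
    by case: mv => h; [exact: esym (move_Hcoef n h)|exact: move_Hcoef].
  exact: etrans (congr1 (fun h => Hcoef D n - h) E) (h2 n).
(* The new change receives the index k; the families keep their values below k. *)
- pose ext (T : Type) (g : nat -> T) x i := if (i < k)%N then g i else x.
  exists (ext _ eps eps'), (ext _ N N'), (ext _ p p'), (maxn M M'); split.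
  + by move=> i; rewrite /ext; case: ifP.
  + move=> n; rewrite big_ord_recr /= /ext ltnn -h2'.
    apply: (etrans (esym (subrKA (Hcoef D1 n) _ _))); congr (_ + _).
    by apply: (etrans (h2 n)); apply: eq_bigr => i _; rewrite ltn_ord.
  + move=> i n; rewrite geq_max /ext => _ /andP[Mn Mn'].
    by case: ifP => ik; [exact: h3|exact: h3'].
Qed.

Lemma equivalent_Hcoef D D' n : equivalent D D' -> Hcoef D n = Hcoef D' n.
Proof.
move=> /transformable_Hcoef[eps [N [p [M [_ h _]]]]].
by apply/eqP; rewrite -subr_eq0 h big_ord0.
Qed.

End CrossingChange.

(** * Collecting equal terms *)

Section Collect.
Variables (T : zmodType) (k : nat) (b : nat -> T).

(* Every nonzero value of b below k is taken at exactly one leading index. *)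
Definition leading m :=
  [&& (m < k)%N, b m != 0 & index (b m) (map b (iota 0 k)) == m].

Lemma leading_inj m m' : leading m -> leading m' -> b m = b m' -> m = m'.
Proof.
by move=> /and3P[_ _ /eqP hm] /and3P[_ _ /eqP hm'] bb; rewrite -[LHS]hm bb hm'.
Qed.

(** The indices with nonzero value are partitioned by the first index at which their value occurs,
    and these first indices are the leading ones. *)
Lemma sum_leading (V : nmodType) (F : nat -> V) :
  \sum_(m < k | leading m) \sum_(i < k | b i == b m) F i =
  \sum_(i < k | b i != 0) F i.
Proof.
have b_mem (i : 'I_k) : b i \in map b (iota 0 k).
  by apply: map_f; rewrite mem_iota ltn_ord.
have first_lt (i : 'I_k) : (index (b i) (map b (iota 0 k)) < k)%N.
  by have := b_mem i; rewrite -index_mem size_map size_iota.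
pose first i : 'I_k := Ordinal (first_lt i).
have b_first i : b (first i) = b i.
  have := nth_index 0 (b_mem i).
  by rewrite (nth_map 0%N) ?size_iota ?first_lt // nth_iota ?first_lt // add0n.
rewrite [RHS](partition_big first (fun m : 'I_k => leading m)) => [|i bi] /=.
  apply: eq_bigr => m lm; apply: eq_bigl => i.
  have /and3P[_ bm /eqP im] := lm.
  apply/eqP/andP => [bi|[_ /eqP <-]]; last by rewrite b_first.
  by rewrite bi; split=> //; apply/eqP/val_inj; rewrite /= bi.
have bf : b (index (b i) (map b (iota 0 k))) = b i := b_first i.
by rewrite /leading first_lt bf bi eqxx.
Qed.

End Collect.

(** * The expansion and the lower bound *)

Section Main.
Variable R : realType.

Lemma Hdiag_eventually (D : diagram R) :
  exists M, forall N, (M <= N)%N -> Hdiag D = \sum_(0 <= n < N) Hcoef D n.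
Proof.
by have [M bound] := Hdiag_Hcoef D; exists M => N /bound[].
Qed.

Lemma represents_Hcoef (K : knotoid R) D D' n :
  represents K D -> represents K D' -> Hcoef D n = Hcoef D' n.
Proof.
case: (knotoid_class K) => D0 -> h h'.
have E := @equivalent_Hcoef R D0 D n h; have E' := @equivalent_Hcoef R D0 D' n h'.
exact (etrans (esym E) E').
Qed.

End Main.

Theorem theorem1p4 (R : realType) (K K' : knotoid R) (hKK' : homotopic K K') :
  exists (a : nat -> nat -> int) (N : nat -> nat -> nat)
    (z : nat -> nat -> laurent),
  [/\ finite_set [set i : nat * nat | a i.1 i.2 != 0],
      nonredundant a N z,
      forall D D' : diagram R, represents K D -> represents K' D' ->
        Hdiag D - Hdiag D' =
          \sum_(n \in [set: nat]) \sum_(m \in [set: nat])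
            a n m *: bterm (N n m) (z n m) n
    & forall n : nat,
        \sum_(m \in [set: nat]) `|a n m| <= (gordian_distance hKK')%:Z].
Proof.
(* The minimum defining the Gordian distance is attained by some pair of representatives. *)
have /asboolP[D0 [D0' [KD0 KD0' /transformable_Hcoef]]] :
  `[< changes K K' (gordian_distance hKK') >].
  by rewrite /gordian_distance; case: ex_minnP.
set k := gordian_distance hKK'.
move=> [eps [N [p [M [heps diff large]]]]].
pose b n m := bterm (N m) (p m n) n.
(* All crossing changes with the same nonzero term are collected at the first of them, which ensures
   nonredundancy. *)
pose a n m : int :=
  if leading k (b n) m then \sum_(i < k | b n i == b n m) eps i else 0.
have a_leading n m : a n m != 0 -> leading k (b n) m.
  by rewrite /a; case: ifP => // _; rewrite eqxx.
have a_large n m : (k <= m)%N -> a n m = 0.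
  by move=> km; rewrite /a /leading ltnNge km.
(* Vanishing terms are discarded and the others grouped by their value. *)
have diffE n : \sum_(m \in [set: nat]) a n m *: b n m = Hcoef D0 n - Hcoef D0' n.
  rewrite (@fsbig_nat_lt _ _ k) => [|m /a_large ->]; last by rewrite scale0r.
  rewrite big_mkord diff [RHS](bigID (fun i : 'I_k => b n i == 0)) /=.
  rewrite [X in _ = X + _]big1 ?add0r => [|i /eqP]; last first.
    by rewrite /b => ->; rewrite scaler0.
  rewrite -(sum_leading k (b n) (fun i => eps i *: b n i)) [RHS]big_mkcond /=.
  apply: eq_bigr => m _; rewrite /a; case: ifP => _; last by rewrite scale0r.
  by rewrite scaler_suml; apply: eq_bigr => i /eqP ->.
exists a, (fun _ m => N m), (fun n m => p m n); split.
(* Leading indices are below k, and for n from M on all terms [b n m] vanish. *)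
- apply: (@sub_finite_set _ _ (`I_M `*` `I_k)); last exact: finite_setX.
  move=> [n m] /= /a_leading /and3P[mk bm _]; split=> //=.
  rewrite ltnNge; apply: contraNN bm => Mn.
  by rewrite /b large // bterm0.
- move=> n m anm; have lm := a_leading n m anm; split; first by have /and3P[] := lm.
  move=> m' /a_leading lm'; apply: contra_neq => bb.
  exact: leading_inj lm lm' bb.
- move=> D D' KD KD'.
  (* Both functions and the expansion are cut off at a common bound; invariance then passes from D0,
     D0' to arbitrary representatives. *)
  have [M1 H1] := Hdiag_eventually D; have [M2 H2] := Hdiag_eventually D'.
  pose B := maxn M (maxn M1 M2).
  rewrite (H1 B) ?(H2 B) ?leq_max ?leqnn ?orbT // (@fsbig_nat_lt _ _ B).
    rewrite -sumrB; apply: eq_bigr => n _; rewrite -/(b n _) diffE.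
    have E := @represents_Hcoef _ _ _ _ n KD0 KD.
    have E' := @represents_Hcoef _ _ _ _ n KD0' KD'.
    exact (esym (congr2 (fun h h' => h - h') E E')).
  move=> n Bn; rewrite diffE diff big1 // => i _.
  rewrite large ?bterm0 ?scaler0 //.
  by apply: leq_trans Bn; rewrite leq_maxl.
- move=> n; rewrite (@fsbig_nat_lt _ _ k) => [|m /a_large ->]; last by rewrite normr0.
  (* For a leading m, |a n m| is at most the number of crossing changes collected at m; these
     classes are disjoint, so the total is at most k. *)
  rewrite big_mkord; apply: (@le_trans _ _
    (\sum_(m < k | leading k (b n) m) \sum_(i < k | b n i == b n m) 1%:Z)).
    rewrite [leRHS]big_mkcond /=; apply: ler_sum => m _; rewrite /a.
    case: ifP => _; last by rewrite normr0.
    apply: (le_trans (ler_norm_sum _ _ _)); apply: ler_sum => i _.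
    by case: (heps i) => ->.
  rewrite (sum_leading k (b n) (fun=> 1%:Z)).
  apply: (@le_trans _ _ (\sum_(i < k) 1%:Z)).
    by rewrite [leLHS]big_mkcond /=; apply: ler_sum => i _; case: ifP.
  by rewrite sumr_const card_ord -mulr_natl mulr1 natz.
Qed.
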